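(* Given a graph $G$ together with a nice tree decomposition of $G$ of width $\mathrm{tw}$, there is an algorithm that computes the size of a maximum acyclic matching of $G$ in time $5^{\mathrm{tw}} n^{O(1)}$, where $n=|V(G)|$. The algorithm is randomized, cannot give false positives, and may give false negatives with probability at most $1/3$.
   Context: All graphs are finite, simple and undirected. For a set of edges $M$, $V_M$ denotes the vertices incident with edges of $M$. A matching $M$ of $G$ is acyclic if $G[V_M]$ is a forest (acyclic). Nice tree decompositions are in the standard sense (rooted tree decompositions with leaf, introduce, forget and join nodes). *)

(* Defs.v *)
From HB Require Import structures.
From mathcomp Require Import all_boot all_order all_algebra.

Set Implicit Arguments.
Unset Strict Implicit.
Unset Printing Implicit Defensive.

(* A finite simple undirected graph is a finite type [V] with
   a symmetric and irreflexive adjacency relation [e : rel V]. *)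

Section Graphs.
Variables (V : finType) (e : rel V).

Definition edges : {set {set V}} :=
  [set A : {set V} | [exists x, exists y, (A == [set x; y]) && e x y]].

Definition matching (M : {set {set V}}) : Prop :=
  M \subset edges /\ trivIset M.

Definition induced (S : {set V}) : rel V :=
  [rel x y | [&& x \in S, y \in S & e x y]].

(* Closed walks without repeated vertices and of length 1 or 2 are not cycles
   of a simple graph. *)
Definition forest (r : rel V) : Prop :=
  forall s : seq V, ucycle r s -> size s <= 2.

(* [cover M] is the set V_M of the vertices incident with an edge of M. *)
Definition acyclic_matching (M : {set {set V}}) : Prop :=
  matching M /\ forest (induced (cover M)).

Definition max_acyclic_matching_size (k : nat) : Prop :=
  (exists2 M, acyclic_matching M & #|M| = k) /\
  (forall M, acyclic_matching M -> #|M| <= k).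

End Graphs.

Inductive ntd (V : Type) : Type :=
| Leaf
| Introduce of V & ntd V
| Forget of V & ntd V
| Join of ntd V & ntd V.

Section TreeDecompositions.
Variable V : finType.

Fixpoint bag (t : ntd V) : {set V} :=
  match t with
  | Leaf => set0
  | Introduce v u => v |: bag u
  | Forget v u => bag u :\ v
  | Join u _ => bag u
  end.

Fixpoint nice (t : ntd V) : bool :=
  match t with
  | Leaf => true
  | Introduce v u => (v \notin bag u) && nice u
  | Forget v u => (v \in bag u) && nice u
  | Join u1 u2 => [&& bag u1 == bag u2, nice u1 & nice u2]
  end.

(* A node of the decomposition tree is addressed by the path leading to it from
   the root; the only child of an Introduce or Forget node is child [false]. *)
Fixpoint subtree (t : ntd V) (p : seq bool) {struct p} : option (ntd V) :=
  match p, t with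
  | [::], _ => Some t
  | false :: q, Introduce _ u => subtree u q
  | false :: q, Forget _ u => subtree u q
  | b :: q, Join u1 u2 => subtree (if b then u2 else u1) q
  | _, _ => None
  end.

Definition in_bag (t : ntd V) (v : V) : pred (seq bool) :=
  fun p => if subtree t p is Some u then v \in bag u else false.

Definition tree_adj : rel (seq bool) :=
  fun p q => [|| q == rcons p false, q == rcons p true,
                 p == rcons q false | p == rcons q true].

(* The last condition says that the nodes whose bags contain [v] induce a
   connected subgraph of the decomposition tree. *)
Definition tree_decomposition (e : rel V) (t : ntd V) : Prop :=
  [/\ forall v, exists p, in_bag t v p,
      forall x y, e x y -> exists p, in_bag t x p && in_bag t y p
    & forall v p q, in_bag t v p -> in_bag t v q ->
        exists s, [&& path tree_adj p s, last p s == q & all (in_bag t v) s]].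

(* Leaf bags are empty by definition of [bag]; the root bag is empty too. *)
Definition nice_tree_decomposition (e : rel V) (t : ntd V) : Prop :=
  [/\ nice t, bag t = set0 & tree_decomposition e t].

Fixpoint num_nodes (t : ntd V) : nat :=
  match t with
  | Leaf => 1
  | Introduce _ u | Forget _ u => (num_nodes u).+1
  | Join u1 u2 => (num_nodes u1 + num_nodes u2).+1
  end.

Fixpoint max_bag (t : ntd V) : nat :=
  match t with
  | Leaf => 0
  | Introduce _ u | Forget _ u => maxn #|bag t| (max_bag u)
  | Join u1 u2 => maxn #|bag t| (maxn (max_bag u1) (max_bag u2))
  end.

(* Truncated subtraction: 0 instead of -1 when all the bags are empty. *)
Definition width (t : ntd V) : nat := (max_bag t).-1.

End TreeDecompositions.

(* Model of computation: an abstract machine for an untyped call-by-value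
   functional language whose first-order data are binary trees.  There are no
   primitive numbers, arithmetic or equality tests.  Variables are de Bruijn
   indices.  Running time is the number of machine transitions.  With values and
   environments represented by pointers, each transition of a fixed program
   takes a constant number of pointer operations (a variable is looked up by
   following at most as many links as its index, a constant of the program);
   conversely T steps of a random access machine are simulated with a factor
   polynomial in log T by keeping the memory in a balanced tree. *)
Inductive term : Type :=
| TVar of nat
| TFix of term                (* in the body, 0 = argument, 1 = the function *)
| TApp of term & term
| TNil
| TCons of term & term
| TCase of term & term & term (* in the last branch, 0 = left, 1 = right *)
| TFlip.                      (* one fair random bit *)

Inductive value : Type :=
| VNil
| VCons of value & value
| VClos of seq value & term.

Inductive frame : Type :=
| FAppL of term & seq value
| FAppR of value
| FConsL of term & seq value
| FConsR of value
| FCase of term & term & seq value.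

Definition stack := seq frame.

(* The last component is the part of the random tape not read so far. *)
Inductive state : Type :=
| Eval of term & seq value & stack & seq bool
| Ret of value & stack & seq bool.

Definition enc_bool (b : bool) : value := if b then VCons VNil VNil else VNil.

(* [None]: final or stuck.  Reading beyond the end of the tape is stuck. *)
Definition step (st : state) : option state :=
  match st with
  | Eval (TVar i) E K w => omap (fun v => Ret v K w) (onth E i)
  | Eval (TFix t) E K w => Some (Ret (VClos E t) K w)
  | Eval (TApp t u) E K w => Some (Eval t E (FAppL u E :: K) w)
  | Eval TNil E K w => Some (Ret VNil K w)
  | Eval (TCons t u) E K w => Some (Eval t E (FConsL u E :: K) w)
  | Eval (TCase t u1 u2) E K w => Some (Eval t E (FCase u1 u2 E :: K) w)
  | Eval TFlip E K (b :: w) => Some (Ret (enc_bool b) K w)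
  | Ret v (FAppL u E :: K) w => Some (Eval u E (FAppR v :: K) w)
  | Ret v (FAppR (VClos E t) :: K) w => Some (Eval t (v :: VClos E t :: E) K w)
  | Ret v (FConsL u E :: K) w => Some (Eval u E (FConsR v :: K) w)
  | Ret v (FConsR v1 :: K) w => Some (Ret (VCons v1 v) K w)
  | Ret VNil (FCase u1 u2 E :: K) w => Some (Eval u1 E K w)
  | Ret (VCons a b) (FCase u1 u2 E :: K) w => Some (Eval u2 (a :: b :: E) K w)
  | _ => None
  end.

(* The final value if the machine halts after at most [B] transitions. *)
Fixpoint run (B : nat) (st : state) : option value :=
  if st is Ret v [::] _ then Some v
  else if B is B'.+1 then obind (run B') (step st) else None.

(* Unary numerals: apart from the tags below, the numbers in inputs and outputs
   are at most the number of vertices. *)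
Definition enc_nat (k : nat) : value := iter k (VCons VNil) VNil.

Fixpoint dec_nat (v : value) : option nat :=
  match v with
  | VNil => Some 0
  | VCons _ u => omap succn (dec_nat u)
  | VClos _ _ => None
  end.

Definition enc_list (s : seq value) : value := foldr VCons VNil s.

(* Adjacency matrix. *)
Definition enc_graph n (e : rel 'I_n) : value :=
  enc_list [seq enc_list [seq enc_bool (e i j) | j <- enum 'I_n]
           | i <- enum 'I_n].

Fixpoint enc_ntd n (t : ntd 'I_n) : value :=
  match t with
  | Leaf => enc_list [:: enc_nat 0]
  | Introduce v u => enc_list [:: enc_nat 1; enc_nat v; enc_ntd u]
  | Forget v u => enc_list [:: enc_nat 2; enc_nat v; enc_ntd u]
  | Join u1 u2 => enc_list [:: enc_nat 3; enc_ntd u1; enc_ntd u2]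
  end.

(* The number output by program [p] within [B] transitions when its free
   variable 0 is bound to the input (graph, decomposition) and its random bits
   are read from [w]. *)
Definition output n (p : term) (e : rel 'I_n) (t : ntd 'I_n) (w : seq bool)
    (B : nat) : option nat :=
  obind dec_nat (run B (Eval p [:: VCons (enc_graph e) (enc_ntd t)] [::] w)).

(* Probability over [B] independent fair bits; a run of at most [B] transitions
   reads at most [B] bits. *)
Definition Pr (B : nat) (A : pred (B.-tuple bool)) : rat :=
  (#|A|%:R / (2 ^ B)%:R)%R.

(* Main.v *)
(* Assign to every vertex one of five states: uncovered, or covered, on one of
   two sides of a cut, and marked or not.  Sum over all assignments, in
   characteristic 2, a product of vertex and edge weights that vanishes when an
   edge joins covered vertices on different sides.  Let X be the covered set.
   Modulo 2 the marks leave exactly the sets M of edges of G[X] that cover X,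
   and the cut (Cut & Count) leaves exactly the sets N of X that meet every
   component of G[X].  The exponent of the formal variable 'X is affine in
   D = (2|M| - |X|) + (|N| + |E[X]| - |X|); both summands are nonnegative, and
   D = 0 iff M is a perfect matching of X and G[X] is a forest with one root of
   N per component.  A forest has at most one perfect matching, so the part
   D = 0 is a sum of distinct monomials in vertex variables x_v (v in X \ N) and
   y_v (v in N), and it is nonzero in degree 2k iff there is an acyclic matching
   of size k.  The variables are replaced by random polynomials over F_2: by
   Schwartz-Zippel a nonzero polynomial seldom vanishes, and a zero one always
   does.  Variable elimination along the tree decomposition evaluates the sum
   with tables of at most 5 ^ |bag| entries; a join multiplies tables
   pointwise. *)

Require Import Defs.
From mathcomp Require Import all_boot all_order all_algebra zify.

Set Implicit Arguments.
Unset Strict Implicit.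
Unset Printing Implicit Defensive.

(** * Running the machine *)

(** One formal variable plays three roles. A random value is a polynomial in 'X so short that every
    monomial in the x_v and y_v has length at most [kp]; the size of X shifts it by multiples of
    [kp], and D by multiples of [k], so that these contributions never overlap. All arithmetic thus
    takes place in the integral domain F_2[X] on plain bit lists, and no irreducible polynomial has
    to be found to build a large finite field. The base 5 forbids any convolution of tables at a
    join. Hence every vertex and edge factor is delayed until a vertex is forgotten: the two sides
    of a join then share no factor and no summed variable. Bags have up to tw + 1 vertices; the
    extra factor 5 goes into the polynomial. Each machine program is paired with a function on bit
    lists that it computes within an explicit time bound; graphs and probability are treated on the
    side of these functions only. *)

Fixpoint steps (k : nat) (st : state) : option state :=
  if k is k'.+1 then obind (steps k') (step st) else Some st.

Lemma steps_add j k st st' :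
  steps j st = Some st' -> steps (j + k) st = steps k st'.
Proof.
elim: j st => [|j IH] st; first by case=> ->.
by rewrite addSn /=; case: (step st) => //= st1; apply: IH.
Qed.

Lemma steps_cons k st st' : step st = Some st' ->
  steps (1 + k) st = steps k st'.
Proof. by rewrite add1n /= => ->. Qed.

Lemma steps_run k B st v w : steps k st = Some (Ret v [::] w) -> k <= B ->
  run B st = Some v.
Proof.
elim: k B st => [|k IH] B st /=; first by case=> -> _; case: B.
case: B => // B; case E: (step st) => [st1|] //= H lekB.
have {}IH := IH B st1 H lekB; case: st E => [t F K w'|u [|f K] w'] E //.
2: by case: u E.
all: by transitivity (obind (run B) (Some st1)); rewrite // -E.
Qed.

Lemma step_appl v u E K w :
  step (Ret v (FAppL u E :: K) w) = Some (Eval u E (FAppR v :: K) w).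
Proof. by case: v. Qed.

Lemma step_consl v u E K w :
  step (Ret v (FConsL u E :: K) w) = Some (Eval u E (FConsR v :: K) w).
Proof. by case: v. Qed.

Lemma step_consr v v1 K w :
  step (Ret v (FConsR v1 :: K) w) = Some (Ret (VCons v1 v) K w).
Proof. by case: v. Qed.

Lemma step_beta v t E K w :
  step (Ret v (FAppR (VClos E t) :: K) w) =
    Some (Eval t (v :: VClos E t :: E) K w).
Proof. by case: v. Qed.

(** Quantifying over the stack turns the small-step machine into composable big-step judgements. [T]
    is only an upper bound, so that costs can be rounded up freely. *)
Definition ev T E t w v w' : Prop :=
  forall K, exists2 k, k <= T & steps k (Eval t E K w) = Some (Ret v K w').

Definition app T f a w r w' : Prop :=
  exists E b, f = VClos E b /\ ev T (a :: f :: E) b w r w'.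

Definition branch T v E t u w r w' : Prop :=
  match v with
  | VNil => ev T E t w r w'
  | VCons a b => ev T (a :: b :: E) u w r w'
  | _ => False
  end.

Lemma ev_run T E t w v w' B : ev T E t w v w' -> T <= B ->
  run B (Eval t E [::] w) = Some v.
Proof.
move=> /(_ [::]) [k lekT Hk] leTB; exact: steps_run Hk (leq_trans lekT leTB).
Qed.

Lemma ev_le T' T E t w v v' w' : ev T' E t w v' w' -> T' <= T -> v' = v ->
  ev T E t w v w'.
Proof.
by move=> H leT <- K; have [k lek Hk] := H K; exists k => //; apply: leq_trans leT.
Qed.

Lemma app_le T' T f a w r w' : app T' f a w r w' -> T' <= T ->
  app T f a w r w'.
Proof.
by move=> [E [b [-> H]]] leT; exists E, b; split=> //; apply: ev_le H leT _.
Qed.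

Lemma ev_var E i w v : onth E i = Some v -> ev 1 E (TVar i) w v w.
Proof. by move=> H K; exists 1 => //=; rewrite H. Qed.

(** Keeps the name of a program visible inside its closure, so that the specification of a function
    is found by syntactic matching; the environment is arbitrary because the programs are closed. *)
Definition clo E t : value := if t is TFix b then VClos E b else VNil.

Arguments clo : simpl never.

Lemma ev_clo E t w : (if t is TFix _ then true else false) ->
  ev 1 E t w (clo E t) w.
Proof. by case: t => // b _ K; exists 1. Qed.

Lemma ev_nil E w : ev 1 E TNil w VNil w.
Proof. by move=> K; exists 1. Qed.

Lemma ev_flip E w b : ev 1 E TFlip (b :: w) (enc_bool b) w.
Proof. by move=> K; exists 1. Qed.

Lemma ev_cons T1 T2 E t u w a w1 b w2 :
  ev T1 E t w a w1 -> ev T2 E u w1 b w2 ->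
  ev (T1 + T2 + 3) E (TCons t u) w (VCons a b) w2.
Proof.
move=> H1 H2 K.
have [k1 le1 S1] := H1 (FConsL u E :: K).
have [k2 le2 S2] := H2 (FConsR a :: K).
exists (1 + (k1 + (1 + (k2 + 1)))); first by lia.
rewrite add1n /= (steps_add _ S1) (steps_cons _ (step_consl _ _ _ _ _)).
by rewrite (steps_add _ S2) -[1]addn0 (steps_cons _ (step_consr _ _ _ _)).
Qed.

Lemma ev_case T1 T2 E t u1 u2 w v w1 r w2 :
  ev T1 E t w v w1 -> branch T2 v E u1 u2 w1 r w2 ->
  ev (T1 + T2 + 2) E (TCase t u1 u2) w r w2.
Proof.
move=> H1 H2 K.
have [k1 le1 S1] := H1 (FCase u1 u2 E :: K).
case: v S1 H2 {H1} => [|a b|//] S1 /(_ K) [k2 le2 S2];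
  (exists (1 + (k1 + (1 + k2))); first by lia);
  by rewrite add1n /= (steps_add _ S1) add1n /=.
Qed.

Lemma ev_app T1 T2 T3 E t u w f w1 a w2 r w3 :
  ev T1 E t w f w1 -> ev T2 E u w1 a w2 -> app T3 f a w2 r w3 ->
  ev (T1 + T2 + T3 + 3) E (TApp t u) w r w3.
Proof.
move=> H1 H2 [E' [b [ef H3]]] K; subst f.
have [k1 le1 S1] := H1 (FAppL u E :: K).
have [k2 le2 S2] := H2 (FAppR (VClos E' b) :: K).
have [k3 le3 S3] := H3 K.
exists (1 + (k1 + (1 + (k2 + (1 + k3))))); first by lia.
rewrite add1n /= (steps_add _ S1) (steps_cons _ (step_appl _ _ _ _ _)).
by rewrite (steps_add _ S2) (steps_cons _ (step_beta _ _ _ _ _)).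
Qed.

Lemma app_clo b t T a E w r w' : t = TFix b ->
  ev T (a :: clo E t :: E) b w r w' -> app T (clo E t) a w r w'.
Proof. by move=> -> H; exists E, b. Qed.

(* [tm] builds terms with binders as Rocq functions; its argument is the number
   of enclosing binders, so that level [k] is the index [d - 1 - k]. *)
Definition tm := nat -> term.
Definition lvl (k : nat) : tm := fun d => TVar (Nat.sub (Nat.pred d) k).
Definition fx (f : tm -> tm -> tm) : tm :=
  fun d => TFix (f (lvl d) (lvl (S d)) (S (S d))).
Definition cs (t u : tm) (f : tm -> tm -> tm) : tm :=
  fun d => TCase (t d) (u d) (f (lvl (S d)) (lvl d) (S (S d))).
Definition ap (t u : tm) : tm := fun d => TApp (t d) (u d).
Definition cn (t u : tm) : tm := fun d => TCons (t d) (u d).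
Definition nl : tm := fun _ => TNil.
Definition flip : tm := fun _ => TFlip.
Definition cl (t : term) : tm := fun _ => t.
Definition lett (t : tm) (f : tm -> tm) : tm := ap (fx (fun _ x => f x)) t.
Definition fx2 (f : tm -> tm -> tm -> tm) : tm :=
  fx (fun self x => cs x nl (fun a b => f self a b)).
Definition fx3 (f : tm -> tm -> tm -> tm -> tm) : tm :=
  fx2 (fun self a x => cs x nl (fun b c => f self a b c)).
Definition fx4 (f : tm -> tm -> tm -> tm -> tm -> tm) : tm :=
  fx3 (fun self a b x => cs x nl (fun c d => f self a b c d)).
Definition ap2 f a b := ap f (cn a b).
Definition ap3 f a b c := ap f (cn a (cn b c)).
Definition ap4 f a b c d := ap f (cn a (cn b (cn c d))).
Definition one : tm := cn nl nl.
Definition one_poly : tm := cn one nl.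

Definition all_st_tm : tm :=
  cn nl (cn (cn nl nl) (cn (cn nl one) (cn (cn one nl) (cn (cn one one) nl)))).

Ltac build t :=
  let u := eval cbv [lvl fx cs ap cn nl flip cl lett
                     fx2 fx3 fx4 ap2 ap3 ap4 one one_poly all_st_tm
                     Nat.sub Nat.pred] in (t 0) in exact u.

Definition enc_bits (p : seq bool) : value := enc_list (map enc_bool p).

(* [None]: not covered by the matching; [Some (l, y)]: covered, on the side [l]
   of the cut, and marked iff [y]. *)
Notation vstate := (option (bool * bool)).

Definition enc_st (s : vstate) : value :=
  if s is Some (l, y) then VCons (enc_bool l) (enc_bool y) else VNil.

Definition enc_states (s : seq vstate) : value := enc_list (map enc_st s).

(* Solves a call of a specified function; redefined as specifications are
   proved. *)
Ltac call := fail.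

Ltac exec1 :=
  lazymatch goal with
  | |- ev _ _ (TVar _) _ _ _ => apply: ev_var; reflexivity
  | |- ev _ _ TNil _ _ _ => apply: ev_nil
  | |- ev _ _ TFlip _ _ _ => apply: ev_flip
  | |- ev _ _ (TCons _ _) _ _ _ => eapply ev_cons
  | |- ev _ _ (TCase _ _ _) _ _ _ => eapply ev_case
  | |- ev _ _ (TApp _ _) _ _ _ => eapply ev_app
  | |- ev _ _ _ _ _ _ => apply: ev_clo; reflexivity
  | |- branch _ _ _ _ _ _ _ _ =>
      cbn [branch enc_bits enc_states enc_st enc_list foldr map enc_bool enc_nat iter]
  | |- app _ (clo _ (TFix _)) _ _ _ _ => eapply app_clo; [reflexivity | ]
  | |- app _ _ _ _ _ _ => first [eassumption | call]
  end.

(** Symbolic execution: time bounds remain existential variables until the run is complete, and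
    [sim] then compares their sum with the stated bound. *)
Ltac exec := do ? (progress exec1).
Ltac start := eapply app_clo; [reflexivity | ].
Ltac sim := eapply ev_le; [exec | try lia | try by []].

(** * Bit lists and polynomials over F_2 *)

Definition cat_t : term := ltac:(build (fx2 (fun self p q =>
  cs p q (fun a p' => cn a (ap2 self p' q))))).

Lemma cat_app E w l v :
  app (20 * size l + 20) (clo E cat_t) (VCons (enc_list l) v) w
    (foldr VCons v l) w.
Proof. by elim: l => [|a l IH] /=; start; sim. Qed.

(* A bit list is a polynomial, constant coefficient first; the unary numeral
   [k] is also the list of [k] zero bits, so that multiplication by ['X^k] is
   concatenation. *)
Definition shl (k : nat) (p : seq bool) : seq bool := nseq k false ++ p.

Lemma shl_app E w k p :
  app (20 * k + 20) (clo E cat_t) (VCons (enc_nat k) (enc_bits p)) w (enc_bits (shl k p)) w.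
Proof.
have -> : enc_nat k = enc_list (nseq k VNil) by elim: k => //= k ->.
have -> : enc_bits (shl k p) = foldr VCons (enc_bits p) (nseq k VNil) by elim: k => //= k <-.
by have := cat_app E w (nseq k VNil) (enc_bits p); rewrite size_nseq.
Qed.

Lemma add_app E w k m :
  app (20 * k + 20) (clo E cat_t) (VCons (enc_nat k) (enc_nat m)) w
    (enc_nat (k + m)) w.
Proof. by elim: k => [|k IH]; start; sim. Qed.

Fixpoint xorl (p q : seq bool) : seq bool :=
  match p, q with
  | [::], _ => q
  | _, [::] => p
  | a :: p', b :: q' => (a (+) b) :: xorl p' q'
  end.

Definition xor_t : term := ltac:(build (fx2 (fun self p q =>
  cs p q (fun a p' => cs q p (fun b q' =>
    cn (cs a b (fun _ _ => cs b one (fun _ _ => nl))) (ap2 self p' q')))))).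

Lemma xor_app E w p q :
  app (40 * size p + 40) (clo E xor_t) (VCons (enc_bits p) (enc_bits q)) w (enc_bits (xorl p q)) w.
Proof.
elim: p q => [|a p IH] q; first by start; sim.
case: q => [|b q]; first by start; sim.
by move: (IH q) => {}IH; case: a; case: b; start; sim; cbn [size]; lia.
Qed.

Fixpoint mull (p q : seq bool) : seq bool :=
  if p is a :: p' then
    let r := false :: mull p' q in if a then xorl q r else r
  else [::].

Definition mul_t : term := ltac:(build (fx2 (fun self p q =>
  cs p nl (fun a p' => lett (cn nl (ap2 self p' q)) (fun r =>
    cs a r (fun _ _ => ap2 (cl xor_t) q r)))))).

Lemma mul_app E w p q :
  app ((size p + 1) * (40 * size q + 100)) (clo E mul_t) (VCons (enc_bits p) (enc_bits q)) w
    (enc_bits (mull p q)) w.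
Proof.
elim: p => [|a p IH]; first by start; sim.
case: a; start; sim; try by simpl; lia.
  exact: (xor_app _ _ q (false :: mull p q)).
by simpl; lia.
Qed.

Definition nmul_t : term := ltac:(build (fx2 (fun self a b =>
  cs a nl (fun _ a' => ap2 (cl cat_t) b (ap2 self a' b))))).

Ltac call ::= first [eapply shl_app | eapply xor_app | eapply mul_app].

Lemma nmul_app E w a b :
  app ((a + 1) * (20 * b + 60)) (clo E nmul_t) (VCons (enc_nat a) (enc_nat b)) w
    (enc_nat (a * b)) w.
Proof. elim: a => [|a IH]; start; [by sim|]; sim; [exact: add_app|]; simpl; lia. Qed.

Definition nth_t : term := ltac:(build (fx2 (fun self i l =>
  cs i (cs l nl (fun a _ => a)) (fun _ i' => cs l nl (fun _ l' => ap2 self i' l'))))).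

Lemma nth_app E w i l :
  app (20 * i + 20) (clo E nth_t) (VCons (enc_nat i) (enc_list l)) w
    (nth VNil l i) w.
Proof.
elim: i l => [|i IH] [|a l]; start; try by sim.
by move: (IH l) => {}IH; sim.
Qed.

Definition set_t : term := ltac:(build (fx3 (fun self i x l =>
  cs i (cs l nl (fun _ l' => cn x l'))
       (fun _ i' => cs l nl (fun a l' => cn a (ap3 self i' x l')))))).

Lemma set_app E w i x d l : i < size l ->
  app (30 * i + 30) (clo E set_t) (VCons (enc_nat i) (VCons x (enc_list l))) w
    (enc_list (set_nth d l i x)) w.
Proof.
elim: i l => [|i IH] [|a l] //= H; start; first by sim.
by move: (IH l H) => {}IH; sim.
Qed.

Definition drop_t : term := ltac:(build (fx2 (fun self k l =>
  cs k l (fun _ k' => cs l nl (fun _ l' => ap2 self k' l'))))).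

Lemma drop_app E w k l :
  app (20 * k + 20) (clo E drop_t) (VCons (enc_nat k) (enc_list l)) w
    (enc_list (drop k l)) w.
Proof.
elim: k l => [|k IH] l; first by start; sim; rewrite drop0.
case: l => [|a l]; first by start; sim.
by move: (IH l) => {}IH; start; sim.
Qed.

Definition take_t : term := ltac:(build (fx2 (fun self k l =>
  cs k nl (fun _ k' => cs l nl (fun a l' => cn a (ap2 self k' l')))))).

Lemma take_app E w k l :
  app (30 * k + 30) (clo E take_t) (VCons (enc_nat k) (enc_list l)) w
    (enc_list (take k l)) w.
Proof.
elim: k l => [|k IH] l; first by start; sim; rewrite take0.
case: l => [|a l]; first by start; sim.
by move: (IH l) => {}IH; start; sim.
Qed.

Definition any_t : term := ltac:(build (fx (fun self l =>
  cs l nl (fun a l' => cs a (ap self l') (fun _ _ => one))))).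

Lemma any_app E w p :
  app (20 * size p + 20) (clo E any_t) (enc_bits p) w (enc_bool (has id p)) w.
Proof. by elim: p => [|[] p IH]; start; sim; cbn [size]; lia. Qed.

Definition len_t : term := ltac:(build (fx (fun self l =>
  cs l nl (fun a l' => cn nl (ap self l'))))).

Lemma len_app E w l :
  app (20 * size l + 20) (clo E len_t) (enc_list l) w (enc_nat (size l)) w.
Proof. by elim: l => [|a l IH]; start; sim; cbn [size]; lia. Qed.

(** Cut [p] into windows of width [k]: the result is one plus the largest [m < c] for which window
    number [2 * m] contains a one, or 0. Odd windows are skipped because a matching covers an even
    number of vertices. *)
Fixpoint best (c k : nat) (p : seq bool) : nat :=
  if c is c'.+1 then
    let m := best c' k (drop k (drop k p)) in
    if m is 0 then has id (take k p) else m.+1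
  else 0.

Definition best_t : term := ltac:(build (fx3 (fun self c k p =>
  cs c nl (fun _ c' =>
    lett (ap3 self c' k (ap2 (cl drop_t) k (ap2 (cl drop_t) k p))) (fun m =>
    cs m (ap (cl any_t) (ap2 (cl take_t) k p)) (fun _ _ => cn nl m)))))).

Lemma drop_bits_app E w k p :
  app (20 * k + 20) (clo E drop_t) (VCons (enc_nat k) (enc_bits p)) w (enc_bits (drop k p)) w.
Proof. by rewrite /enc_bits map_drop; apply: drop_app. Qed.

Lemma take_bits_app E w k p :
  app (30 * k + 30) (clo E take_t) (VCons (enc_nat k) (enc_bits p)) w (enc_bits (take k p)) w.
Proof. by rewrite /enc_bits map_take; apply: take_app. Qed.

Ltac call ::= first
  [eapply shl_app | eapply xor_app | eapply mul_app | eapply nmul_app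
  | eapply drop_bits_app | eapply take_bits_app | eapply any_app | eapply len_app].

Lemma best_app E w c k p :
  app ((c + 1) * (200 * k + 300)) (clo E best_t)
    (VCons (enc_nat c) (VCons (enc_nat k) (enc_bits p))) w (enc_nat (best c k p)) w.
Proof.
elim: c p => [|c IH] p; first by start; sim.
move: (IH (drop k (drop k p))) => {}IH.
have le1 : size (take k p) <= k by rewrite size_take_min geq_minl.
start; cbn [best]; case: (best c k _) IH => [|m] IH; sim; try by simpl; lia.
by case: has.
Qed.

(** * Tables *)

Definition pair_bits (k : nat) (s s' : vstate) : seq bool :=
  match s, s' with
  | Some (l, y), Some (l', y') =>
      if l (+) l' then [::]
      else shl k (if y && y' then xorl [:: true] (shl k (shl k [:: true]))
                  else [:: true])
  | _, _ => [:: true]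
  end.

Definition pair_t : term := ltac:(build (fx3 (fun self k s s' =>
  cs s one_poly (fun l y => cs s' one_poly (fun l' y' =>
    let same := ap2 (cl cat_t) k (cs y one_poly (fun _ _ =>
                  cs y' one_poly (fun _ _ => ap2 (cl xor_t) one_poly
                    (ap2 (cl cat_t) k (ap2 (cl cat_t) k one_poly))))) in
    cs l (cs l' same (fun _ _ => nl)) (fun _ _ => cs l' nl (fun _ _ => same))))))).

Ltac call ::= first
  [ eapply (shl_app _ _ _ [:: true]) | eapply shl_app
  | eapply (xor_app _ _ [:: true]) | eapply xor_app
  | eapply mul_app | eapply nmul_app
  | eapply drop_bits_app | eapply take_bits_app | eapply any_app | eapply len_app].

Lemma pair_app E w k s s' :
  app (60 * k + 300) (clo E pair_t) (VCons (enc_nat k) (VCons (enc_st s) (enc_st s')))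
    w (enc_bits (pair_bits k s s')) w.
Proof.
case: s s' => [[l y]|] [[l' y']|]; try by start; sim.
by case: l; case: l'; case: y; case: y'; start; sim; simpl; lia.
Qed.

Definition vertex_bits (kp k : nat) (x y : seq bool) (s : vstate) : seq bool :=
  match s with
  | None => shl k (shl k [:: true])
  | Some (l, _) => shl kp (if l then xorl x (shl k y) else x)
  end.

Definition vertex_t : term := ltac:(build (fx4 (fun self kp k s xy =>
  cs s (ap2 (cl cat_t) k (ap2 (cl cat_t) k one_poly)) (fun l _ =>
    cs xy nl (fun x y =>
    ap2 (cl cat_t) kp (cs l x (fun _ _ => ap2 (cl xor_t) x (ap2 (cl cat_t) k y)))))))).

Lemma vertex_app E w kp k s x y :
  app (20 * kp + 40 * k + 40 * size x + 200) (clo E vertex_t)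
    (VCons (enc_nat kp) (VCons (enc_nat k) (VCons (enc_st s) (VCons (enc_bits x) (enc_bits y)))))
    w (enc_bits (vertex_bits kp k x y s)) w.
Proof.
case: s => [[l y0]|]; last by start; sim.
by case: l; start; sim; simpl; lia.
Qed.

Fixpoint edges_bits (k : nat) (st : vstate) (row : seq bool) (s : seq vstate) : seq bool :=
  match row, s with
  | a :: row', u :: s' =>
      if a then mull (pair_bits k st u) (edges_bits k st row' s') else edges_bits k st row' s'
  | _, _ => [:: true]
  end.

Definition edges_t : term := ltac:(build (fx4 (fun self k st row s =>
  cs row one_poly (fun a row' => cs s one_poly (fun u s' =>
    lett (ap4 self k st row' s') (fun r =>
    cs a r (fun _ _ => ap2 (cl mul_t) (ap3 (cl pair_t) k st u) r))))))).

Lemma size_shl k p : size (shl k p) = k + size p.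
Proof. by rewrite size_cat size_nseq. Qed.

Lemma size_xorl p q : size (xorl p q) = maxn (size p) (size q).
Proof.
by elim: p q => [|a p IH] [|b q] //=; rewrite IH maxnSS.
Qed.

Lemma size_mull p q : size (mull p q) <= size p + size q.
Proof.
elim: p => [|a p IH] //=; case: a; rewrite /= ?size_xorl /=; lia.
Qed.

Lemma size_pair_bits k s s' : size (pair_bits k s s') <= 3 * k + 1.
Proof.
case: s s' => [[l y]|] [[l' y']|] //=; try lia.
case: ifP => // _; rewrite size_shl; case: ifP => _ /=; last by lia.
rewrite -/(xorl [:: true] (shl k (shl k [:: true]))) size_xorl !size_shl /=.
lia.
Qed.

Lemma size_vertex_bits kp k x y s r : size x <= r -> size y <= r ->
  size (vertex_bits kp k x y s) <= kp + 2 * k + r + 1.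
Proof.
case: s => [[l y0]|] /= lex ley; rewrite !size_shl /=; last by lia.
by case: l; rewrite ?size_xorl ?size_shl; lia.
Qed.

Lemma size_edges_bits k st row s : size (edges_bits k st row s) <= 1 + size row * (3 * k + 1).
Proof.
elim: row s => [|a row IH] [|u s] //=.
have := IH s; case: a => //= H; last by lia.
have := size_mull (pair_bits k st u) (edges_bits k st row s); have := size_pair_bits k st u; lia.
Qed.

Definition mulcost (S : nat) : nat := (S + 1) * (40 * S + 100).

Lemma mul_app_le S E w p q : size p <= S -> size q <= S ->
  app (mulcost S) (clo E mul_t) (VCons (enc_bits p) (enc_bits q)) w (enc_bits (mull p q)) w.
Proof.
move=> lep leq; apply: app_le (mul_app _ _ _ _) _.
by rewrite leq_mul // leq_add2r // leq_mul.
Qed.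

Ltac call ::= first
  [ eapply (shl_app _ _ _ [:: true]) | eapply shl_app
  | eapply (xor_app _ _ [:: true]) | eapply xor_app
  | eapply pair_app | eapply vertex_app | eapply nmul_app
  | eapply drop_bits_app | eapply take_bits_app | eapply any_app | eapply len_app].

Lemma edges_app S E w k st row s : 1 + size row * (3 * k + 1) <= S ->
  app (size row * (mulcost S + 60 * k + 400) + 60) (clo E edges_t)
    (VCons (enc_nat k) (VCons (enc_st st) (VCons (enc_bits row) (enc_states s)))) w
    (enc_bits (edges_bits k st row s)) w.
Proof.
elim: row s => [|a row IH] [|u s] leS; try by start; sim; simpl; lia.
have {}IH :
  app (size row * (mulcost S + 60 * k + 400) + 60) (clo E edges_t)
    (VCons (enc_nat k) (VCons (enc_st st) (VCons (enc_bits row) (enc_states s)))) w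
    (enc_bits (edges_bits k st row s)) w by apply: IH; simpl in leS; lia.
have mul E' w' : app (mulcost S) (clo E' mul_t)
    (VCons (enc_bits (pair_bits k st u)) (enc_bits (edges_bits k st row s))) w'
    (enc_bits (mull (pair_bits k st u) (edges_bits k st row s))) w'.
  move: leS => /= leS; apply: mul_app_le.
    by have := size_pair_bits k st u; lia.
  by have := size_edges_bits k st row s; lia.
clear leS; case: a; start; sim; try apply: mul; by simpl; lia.
Qed.

Fixpoint sum_bits (l : seq vstate) (f : vstate -> seq bool) : seq bool :=
  if l is st :: l' then xorl (f st) (sum_bits l' f) else [::].

Definition sum_t : term := ltac:(build (fx2 (fun self l f =>
  cs l nl (fun st l' => ap2 (cl xor_t) (ap f st) (ap2 self l' f))))).

Lemma size_sum_bits S l f : (forall st, size (f st) <= S) -> size (sum_bits l f) <= S.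
Proof.
move=> lef; elim: l => [|st l IH] //=; rewrite size_xorl; have := lef st; lia.
Qed.

Lemma sum_app S T E w l f c :
  (forall st, app T c (enc_st st) w (enc_bits (f st)) w) ->
  (forall st, size (f st) <= S) ->
  app (size l * (T + 40 * S + 100) + 60) (clo E sum_t) (VCons (enc_states l) c) w
    (enc_bits (sum_bits l f)) w.
Proof.
move=> Hc lef; elim: l => [|st l IH]; first by start; sim.
by have Hst := Hc st; have lest := lef st; start; sim; simpl; lia.
Qed.

Definition all_st : seq vstate :=
  [:: None; Some (false, false); Some (false, true); Some (true, false);
      Some (true, true)].

(** The uncovered state serves as neutral default outside the bag: its pair weight with any state is
    1, so a whole adjacency row can be multiplied without selecting the neighbours in the bag. *)
Fixpoint restrict (m : seq bool) (s : seq vstate) : seq vstate :=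
  match m, s with
  | b :: m', x :: s' => (if b then x else None) :: restrict m' s'
  | _, _ => [::]
  end.

(* A table is a closure: [c] maps a state list to a bit list in time [T]. *)
Definition table (n T : nat) (c : value) (f : seq vstate -> seq bool) : Prop :=
  forall s w, size s = n -> app T c (enc_states s) w (enc_bits (f s)) w.

(** Memoisation: the result is a decision tree of closures that branches five ways at the positions
    of the mask and ignores the others. All calls of [h] happen while the tree is built, and a
    lookup is then linear. Without this, every lookup would recompute the tables below and the time
    would be exponential in the depth of the decomposition. *)
Definition tab_t : term := ltac:(build (fx2 (fun self m h =>
  let sub m' st := ap2 self m' (fx (fun _ s => ap h (cn st s))) in
  cs m (lett (ap h nl) (fun r => fx (fun _ _ => r))) (fun b m' =>
  cs b (lett (sub m' nl) (fun r => fx (fun _ s => cs s nl (fun _ s' => ap r s'))))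
  (fun _ _ =>
    lett (sub m' nl) (fun r0 => lett (sub m' (cn nl nl)) (fun r1 =>
    lett (sub m' (cn nl one)) (fun r2 => lett (sub m' (cn one nl)) (fun r3 =>
    lett (sub m' (cn one one)) (fun r4 =>
    fx (fun _ s => cs s nl (fun a s' =>
      ap (cs a r0 (fun l y => cs l (cs y r1 (fun _ _ => r2))
                                   (fun _ _ => cs y r3 (fun _ _ => r4)))) s')))))))))))).

(* The closures built by the program are known only up to existence. *)
Definition evx T E t w w' (P : value -> Prop) : Prop :=
  exists2 v, ev T E t w v w' & P v.

Definition appx T f a w w' (P : value -> Prop) : Prop :=
  exists2 v, app T f a w v w' & P v.

Lemma evx_le T' T E t w w' P : evx T' E t w w' P -> T' <= T -> evx T E t w w' P.
Proof. by move=> [v H Pv] leT; exists v => //; apply: ev_le H leT _. Qed.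

Lemma evx_appx T1 T2 T3 E t u w f a P :
  ev T1 E t w f w -> ev T2 E u w a w -> appx T3 f a w w P ->
  evx (T1 + T2 + T3 + 3) E (TApp t u) w w P.
Proof. by move=> Ht Hu [v Hv Pv]; exists v => //; apply: ev_app Hv. Qed.

Lemma evx_let T1 T2 E t b w w1 w2 P Q :
  evx T1 E t w w1 P ->
  (forall v, P v -> evx T2 (v :: clo E (TFix b) :: E) b w1 w2 Q) ->
  evx (T1 + T2 + 4) E (TApp (TFix b) t) w w2 Q.
Proof.
move=> [v Hv Pv] /(_ v Pv) [r Hr Qr]; exists r => //.
by eapply ev_le; [eapply ev_app; [exact: ev_clo | exact: Hv | exact: app_clo Hr]
  | lia | ].
Qed.

Lemma evx_cons T1 T2 E t u w w1 w2 a (P Q : value -> Prop) :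
  ev T1 E t w a w1 -> evx T2 E u w1 w2 P -> (forall c, P c -> Q (VCons a c)) ->
  evx (T1 + T2 + 3) E (TCons t u) w w2 Q.
Proof.
move=> Ha [c Hc Pc] PQ; exists (VCons a c); last exact: PQ.
exact: ev_cons Ha Hc.
Qed.

Lemma evx_case T1 T2 E t u1 u2 w w1 w2 v P :
  ev T1 E t w v w1 ->
  match v with
  | VNil => evx T2 E u1 w1 w2 P
  | VCons a b => evx T2 (a :: b :: E) u2 w1 w2 P
  | _ => False
  end ->
  evx (T1 + T2 + 2) E (TCase t u1 u2) w w2 P.
Proof.
move=> Hv; case: v Hv => [|a b|//] Hv [r Hr Pr]; exists r => //;
  by apply: ev_case Hv _.
Qed.

Lemma appx_clo b t T a E w w' P : t = TFix b ->
  evx T (a :: clo E t :: E) b w w' P -> appx T (clo E t) a w w' P.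
Proof. by move=> eb [v Hv Pv]; exists v => //; apply: app_clo eb Hv. Qed.

Lemma evx_ret T E t w w' v (P : value -> Prop) :
  ev T E t w v w' -> P v -> evx T E t w w' P.
Proof. by move=> H Pv; exists v. Qed.

Ltac xcase := eapply evx_case; [exec |
  cbn [enc_bits enc_states enc_st enc_list foldr map enc_bool enc_nat iter enc_ntd]].

Ltac sub IH T U Hst m f st :=
  eapply (evx_let (T1 := U + 50)
    (P := fun c => table (size m) (60 * (size m + 1)) c (fun s => f (st :: restrict m s))));
  [ eapply evx_le;
    [ eapply evx_appx; [exec | exec | eapply (IH _ (fun s => f (st :: s)) (T + 50))];
      intros ? ? ?; start; sim; [apply (Hst st); assumption | lia]
    | unfold U; lia]
  | intros ? ?].

Lemma tab_app E w m h f T :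
  table (size m) T h f ->
  appx (5 ^ count id m * (T + 200 * (size m + 1))) (clo E tab_t) (VCons (enc_bits m) h) w w
    (fun c => table (size m) (60 * (size m + 1)) c (fun s => f (restrict m s))).
Proof.
elim: m h f T E => [|b m IH] h f T E Hh.
  eapply appx_clo; first reflexivity.
  eapply evx_le.
    xcase; xcase; eapply (evx_let (P := fun v => v = enc_bits (f [::]))).
      eapply evx_ret; last reflexivity.
      by eapply ev_app; [exec | exec | exact: (Hh [::] w erefl)].
    move=> v ->.
    eapply evx_ret; first by exec.
    by move=> s w' /size0nil ->; start; sim.
  by simpl; lia.
(* The function tabulated one level down first prepends a state and then calls [h], hence the extra
   50; the 200 allowed per position leaves room for it. *)
set U := 5 ^ count id m * (T + 50 + 200 * (size m + 1)).
have le1 : 0 < 5 ^ count id m by rewrite expn_gt0.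
eapply appx_clo; first reflexivity.
have Hst st s w' : size s = size m ->
    app T h (VCons (enc_st st) (enc_states s)) w' (enc_bits (f (st :: s))) w'.
  by move=> es; apply: (Hh (st :: s)); rewrite /= es.
case: b Hh => Hh.
  eapply evx_le.
    xcase; xcase; xcase.
    sub IH T U Hst m f (None : vstate). sub IH T U Hst m f (Some (false, false)).
    sub IH T U Hst m f (Some (false, true)).
    sub IH T U Hst m f (Some (true, false)). sub IH T U Hst m f (Some (true, true)).
    eapply evx_ret; first by exec.
    move=> [|a s] w' //= [es].
    move: (H s w' es) (H0 s w' es) (H1 s w' es) (H2 s w' es) (H3 s w' es).
    case: a => [[[] []]|] ? ? ? ? ?; start; sim; lia.
  by rewrite /= expnS /U; move: (5 ^ _) le1 => e le1; lia.
eapply evx_le.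
  xcase; xcase; xcase. sub IH T U Hst m f (None : vstate).
  eapply evx_ret; first by exec.
  move=> [|a s] w' //= [es]; move: (H s w' es) => ?.
  by case: a => [[[] []]|]; start; sim; lia.
by rewrite /= /U; move: (5 ^ _) le1 => e le1; lia.
Qed.

(** Elimination of one variable. The vertex [v] and its edges to the bag are multiplied in at the
    moment when [v] leaves, so that no factor has to be divided out at a join. *)
Definition forget_bits kp k (x y row : seq bool) v (F : seq vstate -> seq bool) s :=
  sum_bits all_st (fun st => mull (vertex_bits kp k x y st)
    (mull (edges_bits k st row s) (F (set_nth None s v st)))).

Definition forget_t : term := ltac:(build (fx4 (fun self kp k row xyvcs =>
  cs xyvcs nl (fun xy vcs => cs vcs nl (fun v cs' => cs cs' nl (fun c s =>
  ap2 (cl sum_t) all_st_tm (fx (fun _ st =>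
    ap2 (cl mul_t) (ap4 (cl vertex_t) kp k st xy)
     (ap2 (cl mul_t) (ap4 (cl edges_t) k st row s) (ap c (ap3 (cl set_t) v st s))))))))))).

Definition forget_cost S n kp k T : nat :=
  5 * (2 * mulcost S + n * (mulcost S + 60 * k + 400) + T + 30 * n + 20 * kp +
    40 * k + 80 * S + 1000) + 1000.

Lemma map_set_nth (T1 T2 : Type) (f : T1 -> T2) x0 y0 s i x : i < size s ->
  map f (set_nth x0 s i x) = set_nth y0 (map f s) i (f x).
Proof. by elim: s i => [|a s IH] [|i] //= H; rewrite IH. Qed.

Lemma setS_app E w n v st s : size s = n -> v < n ->
  app (30 * v + 30) (clo E set_t) (VCons (enc_nat v) (VCons (enc_st st) (enc_states s))) w
    (enc_states (set_nth None s v st)) w.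
Proof.
move=> es ltv; rewrite /enc_states (map_set_nth _ _ VNil) ?es //.
by apply: set_app; rewrite size_map es.
Qed.

Lemma forget_app E w S r n kp k T x y row v c F s :
  table n T c F -> size s = n -> v < n -> size row <= n ->
  size x <= r -> size y <= r ->
  (forall s, kp + 2 * k + r + 1 + (1 + n * (3 * k + 1)) + size (F s) <= S) ->
  app (forget_cost S n kp k T) (clo E forget_t)
    (VCons (enc_nat kp) (VCons (enc_nat k) (VCons (enc_bits row) (VCons
      (VCons (enc_bits x) (enc_bits y)) (VCons (enc_nat v) (VCons c (enc_states s))))))) w
    (enc_bits (forget_bits kp k x y row v F s)) w.
Proof.
move=> Hc es ltv lerow lex ley leS.
have leep st : size (edges_bits k st row s) <= 1 + n * (3 * k + 1).
  apply: leq_trans (size_edges_bits _ _ _ _) _.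
  by rewrite leq_add2l leq_mul2r lerow orbT.
have lefl st := size_vertex_bits kp k st lex ley.
have leSn : 1 + size row * (3 * k + 1) <= S.
  have := leS s; have : size row * (3 * k + 1) <= n * (3 * k + 1).
    by rewrite leq_mul2r lerow orbT.
  lia.
have mul1 st E' w' : app (mulcost S) (clo E' mul_t)
  (VCons (enc_bits (edges_bits k st row s)) (enc_bits (F (set_nth None s v st)))) w'
  (enc_bits (mull (edges_bits k st row s) (F (set_nth None s v st)))) w'.
  apply: mul_app_le; last by have := leS (set_nth None s v st); lia.
  by have := leS s; have := leep st; lia.
have mul2 st E' w' : app (mulcost S) (clo E' mul_t)
  (VCons (enc_bits (vertex_bits kp k x y st))
    (enc_bits (mull (edges_bits k st row s) (F (set_nth None s v st))))) w'
  (enc_bits (mull (vertex_bits kp k x y st) (mull (edges_bits k st row s) (F (set_nth None s v st))))) w'.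
  apply: mul_app_le; first by have := leS s; have := lefl st; lia.
  apply: leq_trans (size_mull _ _) _.
  by have := leep st; have := leS (set_nth None s v st); lia.
have szs st : size (set_nth None s v st) = n.
  by rewrite size_set_nth es; apply/maxn_idPr.
have setH st E' w' := setS_app E' w' st es ltv.
have cH st w' := Hc _ w' (szs st).
have lemm st : size (mull (vertex_bits kp k x y st)
    (mull (edges_bits k st row s) (F (set_nth None s v st)))) <= S.
  apply: leq_trans (size_mull _ _) _.
  have := size_mull (edges_bits k st row s) (F (set_nth None s v st)).
  by have := leep st; have := lefl st; have := leS (set_nth None s v st); lia.
have xS : size x <= S by have := leS s; lia.
start; sim.
  eapply (fun H => @sum_app S (2 * mulcost S + n * (mulcost S + 60 * k + 400) + T
    + 30 * n + 20 * kp + 40 * k + 40 * S + 600) _ _ all_st _ _ H lemm).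
  move=> st; start; sim; [eapply edges_app; exact leSn | eapply setH | eapply cH
    | eapply mul1 | eapply mul2 | ].
  have lerow2 : size row * (mulcost S + 60 * k + 400) <=
    n * (mulcost S + 60 * k + 400) by rewrite leq_mul2r lerow orbT.
  by move: (mulcost S) lerow2 => m lerow2; lia.
by rewrite /forget_cost /=; move: (mulcost S) => m; lia.
Qed.

(** * Dynamic programming *)

(* Returns the indicator list of the bag and the table of the node.  As the
   uncovered state is encoded by [VNil], the numeral [n] is also the empty bag
   and the all-uncovered state list. *)
Definition dp_t : term := ltac:(build (fx2 (fun self p t =>
  cs p nl (fun rows p1 => cs p1 nl (fun rnd p2 => cs p2 nl (fun kp k =>
  cs t nl (fun tag args => cs tag
    (cn (ap (cl len_t) rows) (fx (fun _ _ => one_poly)))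
    (fun _ tag1 => cs args nl (fun a rest => cs rest nl (fun b _ => cs tag1
      (lett (ap2 self p b) (fun r => cs r nl (fun m c =>
        cn (ap3 (cl set_t) a one m) c)))
      (fun _ tag2 => cs tag2
        (lett (ap2 self p b) (fun r => cs r nl (fun m c =>
          lett (ap3 (cl set_t) a nl m) (fun m' =>
          lett (ap2 (cl nth_t) a rows) (fun row =>
          lett (ap2 (cl nth_t) a rnd) (fun xy =>
          cn m' (ap2 (cl tab_t) m' (fx (fun _ s =>
            ap4 (cl forget_t) kp k row (cn xy (cn a (cn c s))))))))))))
        (fun _ _ => lett (ap2 self p a) (fun r1 => lett (ap2 self p b) (fun r2 =>
          cs r1 nl (fun m c1 => cs r2 nl (fun _ c2 =>
          cn m (ap2 (cl tab_t) m (fx (fun _ s =>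
            ap2 (cl mul_t) (ap c1 s) (ap c2 s)))))))))))))))))))).

Section DynamicProgram.

Variables (n r kp k : nat) (rows : seq (seq bool)) (rnd : seq (seq bool * seq bool)).
Hypotheses (size_rows : size rows = n) (size_rnd : size rnd = n).
Hypothesis size_row : forall i, size (nth [::] rows i) <= n.
Hypothesis size_xy : forall i,
  size (nth ([::], [::]) rnd i).1 <= r /\ size (nth ([::], [::]) rnd i).2 <= r.

Definition bag_mask (t : ntd 'I_n) : seq bool := [seq i \in bag t | i <- enum 'I_n].

(** An introduce node passes on the table of its child: that table ignores positions outside the
    child's bag, and the new vertex has no factor before it is forgotten. *)
Fixpoint dp_bits (t : ntd 'I_n) (s : seq vstate) : seq bool :=
  match t with
  | Leaf => [:: true]
  | Introduce _ u => dp_bits u s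
  | Forget v u =>
      let xy := nth ([::], [::]) rnd v in
      forget_bits kp k xy.1 xy.2 (nth [::] rows v) v (dp_bits u) (restrict (bag_mask t) s)
  | Join u1 u2 =>
      mull (dp_bits u1 (restrict (bag_mask t) s)) (dp_bits u2 (restrict (bag_mask t) s))
  end.

Definition node_size : nat := kp + 2 * k + r + 1 + (1 + n * (3 * k + 1)).

(** A node adds at most one vertex factor and one row of edge factors, and lengths add up at a join.
    Hence entries have polynomial length even though they are sums over exponentially many
    assignments. *)
Lemma size_dp_bits t s : size (dp_bits t s) <= num_nodes t * node_size.
Proof.
elim: t s => [|v u IH|v u IH|u1 IH1 u2 IH2] s /=.
- by rewrite /node_size; lia.
- by apply: leq_trans (IH s) _; rewrite mulSn leq_addl.
- apply: size_sum_bits => st; apply: leq_trans (size_mull _ _) _.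
  have [lex ley] := size_xy v.
  have := size_vertex_bits kp k st lex ley.
  set s' := restrict _ _; set ep := edges_bits _ _ _ _; set F := dp_bits _ _.
  have := size_mull ep F.
  have : size ep <= 1 + n * (3 * k + 1).
    apply: leq_trans (size_edges_bits _ _ _ _) _.
    by rewrite leq_add2l leq_mul2r size_row orbT.
  have : size F <= num_nodes u * node_size by apply: IH.
  by rewrite (mulSn (num_nodes u)); move: (_ * node_size) => z; rewrite /node_size; lia.
- apply: leq_trans (size_mull _ _) _.
  apply: leq_trans (leq_add (IH1 _) (IH2 _)) _.
  by rewrite -mulnDl leq_mul2r leqnSn orbT.
Qed.

Lemma size_bag_mask t : size (bag_mask t) = n.
Proof. by rewrite size_map size_enum_ord. Qed.

Lemma count_bag_mask t : count id (bag_mask t) = #|bag t|.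
Proof.
rewrite count_map cardE size_filter enumT; exact: eq_count.
Qed.

Lemma bag_mask_set v b (t u : ntd 'I_n) :
  (forall i, (i \in bag t) = if i == v then b else i \in bag u) ->
  enc_list (set_nth VNil (map enc_bool (bag_mask u)) v (enc_bool b)) = enc_bits (bag_mask t).
Proof.
move=> H; rewrite -(map_set_nth _ false) ?size_bag_mask //; congr (enc_list (map _ _)).
have szt : size (set_nth false (bag_mask u) v b) = n.
  by rewrite size_set_nth size_bag_mask; apply/maxn_idPr.
apply: (@eq_from_nth _ false); first by rewrite szt size_bag_mask.
rewrite szt => i lti; rewrite nth_set_nth /=.
have E (w : ntd 'I_n) : nth false (bag_mask w) i = (Ordinal lti \in bag w).
  rewrite (nth_map (Ordinal lti)) ?size_enum_ord //.
  by rewrite -[i in LHS]/(val (Ordinal lti)) nth_ord_enum.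
by rewrite !E H -val_eqE.
Qed.

Definition enc_rows : value := enc_list (map enc_bits rows).
Definition enc_rnd : value :=
  enc_list (map (fun xy => VCons (enc_bits xy.1) (enc_bits xy.2)) rnd).
Definition enc_par : value :=
  VCons enc_rows (VCons enc_rnd (VCons (enc_nat kp) (enc_nat k))).

Definition lookup_cost : nat := 60 * (n + 1).

Definition node_cost S b : nat :=
  5 ^ b * (forget_cost S n kp k lookup_cost + mulcost S + 2 * lookup_cost
    + 500 * n + 2000).

Lemma nth_rows_app E w (v : 'I_n) :
  app (20 * v + 20) (clo E nth_t) (VCons (enc_nat v) enc_rows) w
    (enc_bits (nth [::] rows v)) w.
Proof. by rewrite -(nth_map _ VNil) ?size_rows //; apply: nth_app. Qed.

Lemma nth_rnd_app E w (v : 'I_n) (xy := nth ([::], [::]) rnd v) :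
  app (20 * v + 20) (clo E nth_t) (VCons (enc_nat v) enc_rnd) w
    (VCons (enc_bits xy.1) (enc_bits xy.2)) w.
Proof.
rewrite -(nth_map _ VNil (fun xy => VCons (enc_bits xy.1) (enc_bits xy.2))) ?size_rnd //.
exact: nth_app.
Qed.

Lemma enc_nat_mask : enc_nat n = enc_bits (bag_mask (@Leaf 'I_n)).
Proof.
rewrite /bag_mask /enc_bits -map_comp (eq_map (g := fun=> VNil)) => [|i /=]; last by rewrite inE.
rewrite -[in LHS](size_enum_ord n); elim: (enum _) => //= _ l <-; exact: iterS.
Qed.

Lemma setm_app E w b v (t u : ntd 'I_n) :
  (forall i, (i \in bag t) = if i == v then b else i \in bag u) ->
  app (30 * v + 30) (clo E set_t)
    (VCons (enc_nat v) (VCons (enc_bool b) (enc_bits (bag_mask u)))) w (enc_bits (bag_mask t)) w.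
Proof.
by move=> H; rewrite -(bag_mask_set H); apply: set_app; rewrite size_map size_bag_mask.
Qed.

(** Only forget and join nodes tabulate, with [5 ^ #|bag|] entries each, and an entry costs
    polynomial time because the tables of the children answer within [lookup_cost]. *)
Lemma dp_app E w S b t :
  nice t -> max_bag t <= b -> num_nodes t * node_size <= S ->
  appx (num_nodes t * node_cost S b) (clo E dp_t) (VCons enc_par (enc_ntd t)) w w
    (fun v => exists2 c, v = VCons (enc_bits (bag_mask t)) c & table n lookup_cost c (dp_bits t)).
Proof.
have pos5 : 0 < 5 ^ b by rewrite expn_gt0.
elim: t => [|v u IH|v u IH|u1 IH1 u2 IH2].
- move=> _ _ _; eapply appx_clo; first reflexivity.
  eapply evx_le.
    xcase; xcase; xcase; xcase; xcase; xcase.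
    eapply evx_ret; first by exec.
    eexists; first by rewrite size_map size_rows enc_nat_mask.
    move=> s w' es; start; sim; rewrite /lookup_cost; lia.
  rewrite size_map size_rows /= mul1n /node_cost; move: (5 ^ b) pos5 => e pos5.
  have : 20 * n + 100 <= e * (500 * n + 2000) by nia.
  rewrite mulnDr; lia.
- move=> /= /andP[vu nu]; rewrite geq_max => /andP[_ leb] leS.
  have leSu : num_nodes u * node_size <= S.
    by apply: leq_trans leS; rewrite leq_mul2r leqnSn orbT.
  have setm E' w' : app (30 * v + 30) (clo E' set_t)
      (VCons (enc_nat v) (VCons (VCons VNil VNil) (enc_bits (bag_mask u)))) w'
      (enc_bits (bag_mask (Introduce v u))) w'.
    by apply: (@setm_app _ _ true) => i; rewrite !inE; case: eqP.
  eapply appx_clo; first reflexivity.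
  eapply evx_le.
    do 9 xcase; eapply evx_let.
      by eapply evx_appx; [exec | exec | exact: IH].
    move=> _ [c -> Hc]; xcase; eapply evx_ret; first by exec; eapply setm.
    by exists c.
  have := ltn_ord v; rewrite [num_nodes _]/= (mulSn (num_nodes u)).
  suff : 30 * n + 200 <= node_cost S b by lia.
  by rewrite /node_cost; move: (5 ^ b) pos5 => e pos5; rewrite mulnDr; nia.
- move=> nt lebt leS; case/andP: (nt) => vu nu.
  have leb : max_bag u <= b by move: lebt; rewrite geq_max => /andP[].
  have lebag : #|bag (Forget v u)| <= b by move: lebt; rewrite geq_max => /andP[].
  have leSu : num_nodes u * node_size <= S.
    by apply: leq_trans leS; rewrite leq_mul2r leqnSn orbT.
  have leS' s : kp + 2 * k + r + 1 + (1 + n * (3 * k + 1)) + size (dp_bits u s) <= S.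
    by apply: leq_trans leS; rewrite /= mulSn leq_add2l size_dp_bits.
  have setm E' w' : app (30 * v + 30) (clo E' set_t)
      (VCons (enc_nat v) (VCons VNil (enc_bits (bag_mask u)))) w'
      (enc_bits (bag_mask (Forget v u))) w'.
    by apply: (@setm_app _ _ false) => i; rewrite !inE; case: eqP.
  have [lex ley] := size_xy v.
  eapply appx_clo; first reflexivity.
  eapply evx_le.
    do 10 xcase; eapply evx_let.
      by eapply evx_appx; [exec | exec | exact: IH].
    move=> _ [c -> Hc]; xcase.
    eapply (evx_let (P := fun m' => m' = enc_bits (bag_mask (Forget v u)))).
      by eapply evx_ret; first by exec; eapply setm.
    move=> _ ->; eapply (evx_let (P := fun m' => m' = enc_bits (nth [::] rows v))).
      by eapply evx_ret; first by exec; eapply nth_rows_app.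
    move=> _ ->; eapply (evx_let (P := fun m' =>
        m' = let xy := nth ([::], [::]) rnd v in VCons (enc_bits xy.1) (enc_bits xy.2))).
      by eapply evx_ret; first by exec; eapply nth_rnd_app.
    move=> _ ->; eapply evx_cons; first by exec.
      eapply evx_appx; [exec | exec | ].
      eapply (@tab_app _ _ _ _ _ (forget_cost S n kp k lookup_cost + 60)).
      rewrite size_bag_mask => s w' es; start; sim; [by eapply forget_app; eauto | lia].
    move=> c' Hc'; exists c' => //; move: Hc'; rewrite size_bag_mask; exact.
  rewrite count_bag_mask size_bag_mask.
  have le5 : 5 ^ #|bag (Forget v u)| <= 5 ^ b by rewrite leq_exp2l.
  have := ltn_ord v; rewrite [num_nodes _]/= (mulSn (num_nodes u)).
  set X := forget_cost _ _ _ _ _.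
  have : 5 ^ #|bag (Forget v u)| * (X + 60 + 200 * (n + 1)) <=
      5 ^ b * (X + 60 + 200 * (n + 1)) by rewrite leq_mul2r le5 orbT.
  move: (5 ^ #|_| * _) => z lez.
  suff : z + 100 * n + 500 <= node_cost S b by lia.
  rewrite /node_cost -/X; move: (5 ^ b) pos5 lez => e pos5 lez.
  have : e * (X + 60 + 200 * (n + 1)) + 1 * (300 * n + 1000) <=
     e * (X + 60 + 200 * (n + 1)) + e * (300 * n + 1000).
    by rewrite leq_add2l leq_mul2r pos5 orbT.
  rewrite -mulnDr => H.
  suff : e * (X + 60 + 200 * (n + 1) + (300 * n + 1000)) <=
    e * (X + mulcost S + 2 * lookup_cost + 500 * n + 2000) by lia.
  by rewrite leq_mul2l; apply/orP; right; lia.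
- move=> nt lebt leS; case/and3P: (nt) => /eqP ebag nu1 nu2.
  have [lebag leb1 leb2] : [/\ #|bag (Join u1 u2)| <= b, max_bag u1 <= b
      & max_bag u2 <= b] by move: lebt; rewrite !geq_max => /and3P[].
  have leS12 : num_nodes u1 * node_size + num_nodes u2 * node_size <= S.
    by apply: leq_trans leS; rewrite -mulnDl leq_mul2r leqnSn orbT.
  have leS1 : num_nodes u1 * node_size <= S by lia.
  have leS2 : num_nodes u2 * node_size <= S by lia.
  eapply appx_clo; first reflexivity.
  eapply evx_le.
    do 10 xcase; eapply evx_let.
      by eapply evx_appx; [exec | exec | exact: IH1].
    move=> _ [c1 -> Hc1]; eapply evx_let.
      by eapply evx_appx; [exec | exec | exact: IH2].
    move=> _ [c2 -> Hc2]; do 2 xcase.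
    eapply evx_cons; first by exec.
      eapply evx_appx; [exec | exec | ].
      eapply (@tab_app _ _ _ _ _ (mulcost S + 2 * lookup_cost + 60)).
      rewrite size_bag_mask => s w' es; start.
      eapply ev_le.
      - eapply ev_app; [exec | exec; [exact: Hc1 | exact: Hc2] |].
        apply: (mul_app_le (S := S)).
          by apply: leq_trans (size_dp_bits _ _) _.
        by apply: leq_trans (size_dp_bits _ _) _.
      - by lia.
      - by [].
    move=> c' Hc'; exists c' => //; move: Hc'; rewrite size_bag_mask; exact.
  have -> : count id (bag_mask u1) = #|bag (Join u1 u2)| by apply: count_bag_mask.
  rewrite size_bag_mask.
  have le5 : 5 ^ #|bag (Join u1 u2)| <= 5 ^ b by rewrite leq_exp2l.
  set X := mulcost S + 2 * lookup_cost.
  have : 5 ^ #|bag (Join u1 u2)| * (X + 60 + 200 * (n + 1)) <=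
      5 ^ b * (X + 60 + 200 * (n + 1)) by rewrite leq_mul2r le5 orbT.
  move: (5 ^ #|_| * _) => z lez; rewrite [num_nodes (Join _ _)]/= mulSn mulnDl.
  suff : z + 500 <= node_cost S b by lia.
  rewrite /node_cost; move: (5 ^ b) pos5 lez => e pos5 lez.
  have : e * (X + 60 + 200 * (n + 1)) + 1 * 500 <=
     e * (X + 60 + 200 * (n + 1)) + e * 500.
    by rewrite leq_add2l leq_mul2r pos5 orbT.
  rewrite -mulnDr => H.
  apply: leq_trans (leq_mul (leqnn e) (_ : X + 60 + 200 * (n + 1) + 500 <= _)).
    by lia.
  by rewrite /X; lia.
Qed.

End DynamicProgram.

(** * Random bits and the main program *)

Definition bits_t : term := ltac:(build (fx (fun self k =>
  cs k nl (fun _ k' => cn flip (ap self k'))))).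

Lemma bits_app E w k : k <= size w ->
  app (20 * k + 20) (clo E bits_t) (enc_nat k) w (enc_bits (take k w)) (drop k w).
Proof.
elim: k w => [|k IH] w; first by move=> _; rewrite take0 drop0; start; sim.
by case: w => [//|b w] /IH {}IH; start; sim.
Qed.

Definition rnd_t : term := ltac:(build (fx2 (fun self c r =>
  cs c nl (fun _ c' => cn (cn (ap (cl bits_t) r) (ap (cl bits_t) r))
                          (ap2 self c' r))))).

Fixpoint random_pairs (c r : nat) (w : seq bool) : seq (seq bool * seq bool) :=
  if c is c'.+1 then
    (take r w, take r (drop r w)) :: random_pairs c' r (drop r (drop r w))
  else [::].

Lemma rnd_app w c r : c * (r + r) <= size w -> exists w', forall E,
  app (c * (40 * r + 100) + 20) (clo E rnd_t) (VCons (enc_nat c) (enc_nat r)) w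
    (enc_rnd (random_pairs c r w)) w'.
Proof.
elim: c w => [|c IH] w; first by move=> _; exists w => E; start; sim.
rewrite mulSn => lew.
have [|w' {}IH] := IH (drop r (drop r w)); first by rewrite !size_drop; lia.
have b1 E' : app (20 * r + 20) (clo E' bits_t) (enc_nat r) w (enc_bits (take r w)) (drop r w).
  by apply: bits_app; lia.
have b2 E' : app (20 * r + 20) (clo E' bits_t) (enc_nat r) (drop r w)
    (enc_bits (take r (drop r w))) (drop r (drop r w)).
  by apply: bits_app; rewrite size_drop; lia.
exists w' => E; move: (IH E) => {}IH; start; sim; [eapply b1 | eapply b2 | lia].
Qed.

(** The terms with D = 0 start at exponent [2 * k * n] and fill fewer than [k] places, in which
    window [j] of width [kp] belongs to the covered sets of size [j]. Sizes 0 and 1 are dropped, so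
    the first window seen by [best] stands for a matching of size 1. *)
Definition main_t : term := ltac:(build (fun d => (fun inp =>
  cs inp nl (fun g t =>
  lett (ap (cl len_t) g) (fun n =>
  lett (cn nl (cn nl (cn nl n))) (fun r =>
  lett (ap2 (cl nmul_t) (cn nl n) r) (fun kp =>
  lett (ap2 (cl nmul_t) (cn nl n) kp) (fun k =>
  lett (ap2 (cl rnd_t) n r) (fun rd =>
  lett (ap2 (cl dp_t) (cn g (cn rd (cn kp k))) t) (fun mc => cs mc nl (fun _ c =>
  lett (ap c n) (fun z =>
  lett (ap2 (cl take_t) k (ap2 (cl drop_t) (ap2 (cl nmul_t) n (ap2 (cl cat_t) k k)) z))
    (fun q => ap3 (cl best_t) n kp
      (ap2 (cl drop_t) kp (ap2 (cl drop_t) kp q)))))))))))) ) (lvl 0) (S d))).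

Section Main.

Variable n : nat.

(* A random value has [rbits] bits, so that a product of at most [n] of them fits
   in [kpow] bits, and the shifts by [|X| * kpow] that separate the sizes of the
   covered set fit in [kbig] bits. *)
Definition rbits : nat := n + 3.
Definition kpow : nat := (n + 1) * rbits.
Definition kbig : nat := (n + 1) * kpow.

Definition rows_of (e : rel 'I_n) : seq (seq bool) :=
  [seq [seq e i j | j <- enum 'I_n] | i <- enum 'I_n].

Definition partition_bits (e : rel 'I_n) (t : ntd 'I_n) w : seq bool :=
  dp_bits kpow kbig (rows_of e) (random_pairs n rbits w) t (nseq n None).

Definition answer (e : rel 'I_n) (t : ntd 'I_n) w : nat :=
  best n kpow (drop kpow (drop kpow
    (take kbig (drop (n * (kbig + kbig)) (partition_bits e t w))))).

Definition main_cost N b : nat :=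
  N * node_cost n kpow kbig (N * node_size n rbits kpow kbig) b
  + (n + 2) * (20 * rbits + 60) + (n + 2) * (20 * kpow + 60)
  + n * (40 * rbits + 100) + (n + 1) * (20 * (kbig + kbig) + 60)
  + 20 * (n * (kbig + kbig)) + 100 * kbig + (n + 1) * (200 * kpow + 300)
  + 100 * kpow + 200 * n + 2000.

Lemma size_random_pairs c r w : size (random_pairs c r w) = c.
Proof. by elim: c w => //= c IH w; rewrite IH. Qed.

Lemma size_nth_random_pairs c r w i :
  size (nth ([::], [::]) (random_pairs c r w) i).1 <= r /\
  size (nth ([::], [::]) (random_pairs c r w) i).2 <= r.
Proof.
elim: c w i => [|c IH] w [|i] //=.
by rewrite !size_take_min !geq_minl.
Qed.

Lemma enc_rows_of e : enc_rows (rows_of e) = enc_graph e.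
Proof.
by rewrite /enc_rows /rows_of -map_comp; congr enc_list; apply: eq_map => i /=;
  rewrite /enc_bits -map_comp.
Qed.

Lemma main_ev (e : rel 'I_n) (t : ntd 'I_n) w : nice t -> n * (rbits + rbits) <= size w ->
  exists w', ev (main_cost (num_nodes t) (max_bag t))
    [:: VCons (enc_graph e) (enc_ntd t)] main_t w (enc_nat (answer e t w)) w'.
Proof.
move=> nt lew.
have [w' rnd] := rnd_app lew.
have size_rows : size (rows_of e) = n by rewrite size_map size_enum_ord.
have size_row i : size (nth [::] (rows_of e) i) <= n.
  have [lti|gei] := ltnP i n; last by rewrite nth_default ?size_rows.
  by rewrite (nth_map (Ordinal lti)) ?size_enum_ord // size_map size_enum_ord.
exists w'.
have dp E := dp_app size_rows (size_random_pairs n rbits w) size_row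
  (size_nth_random_pairs n rbits w) E w' nt (leqnn _) (leqnn _).
set ans := answer e t w.
suff [v H ev_ans] : evx (main_cost (num_nodes t) (max_bag t))
    [:: VCons (enc_graph e) (enc_ntd t)] main_t w w' (eq^~ (enc_nat ans)) by rewrite -ev_ans.
have nmul a b E w0 : app ((a + 1) * (20 * b + 60)) (clo E nmul_t)
    (VCons (enc_nat a) (enc_nat b)) w0 (enc_nat (a * b)) w0 := nmul_app E w0 a b.
eapply evx_le.
  rewrite /main_t; xcase; eapply (evx_let (P := eq^~ (enc_nat n))).
    eapply evx_ret; first by exec.
    by rewrite size_map size_enum_ord.
  move=> _ ->; eapply (evx_let (P := eq^~ (enc_nat rbits))).
    eapply evx_ret; first by exec.
    by rewrite /rbits addnC.
  move=> _ ->; eapply (evx_let (P := eq^~ (enc_nat kpow))).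
    eapply evx_ret; first by exec; eapply (nmul n.+1).
    by rewrite /kpow addn1.
  move=> _ ->; eapply (evx_let (P := eq^~ (enc_nat kbig))).
    eapply evx_ret; first by exec; eapply (nmul n.+1).
    by rewrite /kbig addn1.
  move=> _ ->; eapply (evx_let (P := eq^~ (enc_rnd (random_pairs n rbits w)))).
    by eapply evx_ret; first by exec; eapply rnd.
  move=> _ ->; eapply evx_let.
    rewrite -enc_rows_of; eapply evx_appx; [exec | exec | eapply dp].
  move=> _ [c -> Hc]; xcase.
  eapply (evx_let (P := eq^~ (enc_bits (partition_bits e t w)))).
    have Hn : app (lookup_cost n) c (enc_nat n) w' (enc_bits (partition_bits e t w)) w'.
      have -> : enc_nat n = enc_states (nseq n None).
        by rewrite /enc_states map_nseq; elim: (n) => //= m <-; exact: iterS.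
      by apply: Hc; rewrite size_nseq.
    by eapply evx_ret; first by exec.
  move=> _ ->; eapply (evx_let
    (P := eq^~ (enc_bits (take kbig (drop (n * (kbig + kbig)) (partition_bits e t w)))))).
    by eapply evx_ret; first by exec; eapply add_app.
  move=> _ ->; eapply evx_ret; first by exec; eapply best_app.
  by [].
rewrite /main_cost.
move: (num_nodes t * _) => X.
have -> : size [seq enc_list [seq enc_bool (e i j) | j <- enum 'I_n] | i <- enum 'I_n] = n.
  by rewrite size_map size_enum_ord.
rewrite /lookup_cost; lia.
Qed.

End Main.

(** * Forests *)

Section Forests.

Variables (V : finType) (e : rel V).
Hypotheses (e_sym : symmetric e) (e_irr : irreflexive e).
Implicit Types (X L N A : {set V}) (M : {set {set V}}).

Definition edges_in X : {set {set V}} := [set A in edges e | A \subset X].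

Definition unsplit L X : bool :=
  [forall A in edges_in X, [disjoint A & L] || (A \subset L)].

(* Equivalently, [N] meets every connected component of [G[X]]. *)
Definition hits N X : bool :=
  [forall L : {set V}, [&& N \subset L, L \subset X & unsplit L X] ==> (L == X)].

Lemma edgesP A : reflect (exists x y, A = [set x; y] /\ e x y) (A \in edges e).
Proof.
rewrite inE; apply: (iffP existsP) => [[x /existsP[y /andP[/eqP-> exy]]]|].
  by exists x, y.
by move=> [x [y [-> exy]]]; exists x; apply/existsP; exists y; rewrite eqxx.
Qed.

Lemma edge_neq x y : e x y -> x != y.
Proof. by move=> exy; apply: contraTneq exy => ->; rewrite e_irr. Qed.

Lemma card_edge A : A \in edges e -> #|A| = 2.
Proof. by case/edgesP => x [y [-> exy]]; rewrite cards2 edge_neq. Qed.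

Lemma edges_inE X x y : e x y -> ([set x; y] \in edges_in X) = (x \in X) && (y \in X).
Proof.
move=> exy; rewrite in_set subUset !sub1set andb_idl // => _.
by apply/edgesP; exists x, y.
Qed.

Lemma set2_inj (w y u : V) : w != y -> [set w; y] = [set w; u] -> y = u.
Proof.
move=> ne E; have : y \in [set w; u] by rewrite -E !inE eqxx orbT.
by rewrite !inE eq_sym (negPf ne) => /eqP.
Qed.

Lemma edges_in_of w A X : w \in A -> A \in edges_in X ->
  exists u, [/\ A = [set w; u], e w u, w \in X & u \in X].
Proof.
move=> wA; rewrite inE => /andP[/edgesP[x [y [eA exy]]] AX]; subst A.
move: AX wA; rewrite subUset !sub1set !inE => /andP[xX yX] /orP[]/eqP->.
  by exists y.
by exists x; split=> //; rewrite 1?setUC // e_sym.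
Qed.

Lemma forest_sub X X' : X' \subset X -> forest (induced e X) -> forest (induced e X').
Proof.
move=> sub F s /andP[cs us]; apply: F; rewrite /ucycle us andbT.
apply: sub_cycle cs => x y /and3P[xX yX exy].
by rewrite /induced /= exy !(subsetP sub).
Qed.

(** Rotate a cycle so that it starts at [w]: its second and its last vertex are both neighbours of
    [w], hence equal, and the cycle has at most two vertices. *)
Lemma forest_leaf w X :
  (forall y y', y \in X -> y' \in X -> e w y -> e w y' -> y = y') ->
  forest (induced e X) -> forest (induced e (w |: X)).
Proof.
move=> leaf F s /andP[cs us].
have [ws|ws] := boolP (w \in s); last first.
  apply: F; rewrite /ucycle us andbT.
  apply: (sub_in_cycle (P := predC1 w)) cs.
    move=> x y /= xw yw; rewrite /induced /= !inE.
    by rewrite (negPf xw) (negPf yw).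
  by apply/allP => x xs /=; apply: contraNneq ws => <-.
case/rot_to: ws => i p ep.
rewrite -(size_rot i) ep; move: cs us; rewrite -(rot_cycle i) -(rot_uniq i) ep /=.
case: p {ep} => [|y q] //=; rewrite rcons_path.
case/and3P => wy _ lw /and3P[_ yq _].
have inX z : e w z -> z \in w |: X -> z \in X.
  by move=> wz; rewrite in_setU1 eq_sym (negPf (edge_neq wz)).
case/and3P: wy => _ yX wy; case/and3P: lw => lX _ lw; rewrite e_sym in lw.
have eyl : y = last y q by apply: leaf => //; apply: inX.
by case: q yq eyl {lX lw} => // z q yq eyl; rewrite eyl /= mem_last in yq.
Qed.

(** A search started from [N]. As long as [L] is not [X], some edge of G[X] leaves [L]; adding its
    outer end [w] gains one vertex and at least one edge. If the final count is tight, each step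
    gains exactly one edge, so [w] is a leaf when it is added and no cycle ever closes. *)
Lemma grow N X L : N \subset L -> L \subset X -> hits N X ->
  #|L| <= #|N| + #|edges_in L| ->
  (#|L| = #|N| + #|edges_in L| -> forest (induced e L)) ->
  #|X| <= #|N| + #|edges_in X| /\
  (#|X| = #|N| + #|edges_in X| -> forest (induced e X)).
Proof.
move: {2}(#|X| - #|L|) (leqnn (#|X| - #|L|)) => m.
elim: m L => [|m IH] L lem NL LX hit leL eqL.
  suff <- : L = X by [].
  by apply/eqP; rewrite eqEcard LX -subn_eq0 -leqn0.
have [us|] := boolP (unsplit L X).
  move: hit => /forallP/(_ L); rewrite NL LX us /= => /eqP <-.
  by [].
rewrite negb_forall => /existsP[A]; rewrite negb_imply negb_or => /and3P[AE].
rewrite -setI_eq0 => /set0Pn[u]; rewrite inE => /andP[uA uL] AL.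
have [w [eA uw uX wX]] := edges_in_of uA AE.
have wL : w \notin L.
  by apply: contra AL => wL; rewrite eA subUset !sub1set uL.
have AEL : A \notin edges_in L.
  by rewrite inE (negPf AL) andbF.
have subE : A |: edges_in L \subset edges_in (w |: L).
  apply/subsetP => B; rewrite in_setU1 => /orP[/eqP->|].
    by rewrite eA edges_inE // !inE uL eqxx orbT.
  by rewrite !inE => /andP[-> BL]; apply: subset_trans BL (subsetUr _ _).
have cE : #|edges_in L| < #|edges_in (w |: L)|.
  by have := subset_leq_card subE; rewrite cardsU1 AEL.
have cL : #|w |: L| = #|L|.+1 by rewrite cardsU1 wL.
have LX' : w |: L \subset X by rewrite subUset sub1set wX.
have lt1 := subset_leq_card LX'.
have lem' : #|X| - #|w |: L| <= m.
  by move: lem lt1; rewrite cL; move: #|X| #|L| => a b; clear; lia.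
have NL' : N \subset w |: L by apply: subset_trans NL (subsetUr _ _).
have leL' : #|w |: L| <= #|N| + #|edges_in (w |: L)|.
  rewrite cL; move: leL cE; move: #|N| #|L| #|edges_in L| #|edges_in _| => a b c f.
  by clear; lia.
apply: (IH (w |: L) lem' NL' LX' hit leL').
move=> eqL'; apply: forest_leaf; last first.
  apply: eqL; move: eqL' leL cE; rewrite cL.
  by move: #|N| #|L| #|edges_in L| #|edges_in _| => a b c f; clear; lia.
have eE : edges_in (w |: L) = A |: edges_in L.
  apply/esym/eqP; rewrite eqEcard subE cardsU1 AEL.
  move: eqL' leL cE; rewrite cL.
  by move: #|N| #|L| #|edges_in L| #|edges_in _| => a b c f; clear; lia.
have nbr y : y \in L -> e w y -> y = u.
  move=> yL wy; have : [set w; y] \in edges_in (w |: L).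
    by rewrite edges_inE // !inE eqxx yL orbT.
  rewrite eE in_setU1 edges_inE // (negPf wL) orbF eA [[set u; w]]setUC => /eqP.
  by apply: set2_inj; rewrite edge_neq // e_sym.
by move=> y y' yL y'L wy wy'; rewrite (nbr y) // (nbr y').
Qed.

(** This is the second summand of D: nonnegative, and zero only for a forest. The search starts at
    [L = N], where tightness means that [N] spans no edge. *)
Lemma hits_card N X : N \subset X -> hits N X ->
  #|X| <= #|N| + #|edges_in X| /\
  (#|X| = #|N| + #|edges_in X| -> forest (induced e X)).
Proof.
move=> NX hit; apply: (grow (subxx N) NX hit); first exact: leq_addr.
move=> eqN s /andP[cs _]; case: s cs => [|x [|y s]] //= /andP[/and3P[xN yN xy] _].
have : [set x; y] \in edges_in N by rewrite edges_inE ?xN.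
have -> : edges_in N = set0.
  by apply/eqP; rewrite -cards_eq0 -(eqn_add2l #|N|) -eqN addn0.
by rewrite inE.
Qed.

(** Otherwise every vertex of [X] has two neighbours in [X], and a path can always be prolonged
    without turning back. It never meets itself, as that would close a cycle, so it outgrows [V]. *)
Lemma exists_leaf X : X != set0 -> forest (induced e X) ->
  exists2 w, w \in X &
    forall y y', y \in X -> y' \in X -> e w y -> e w y' -> y = y'.
Proof.
move=> X0 F.
pose leaf w := [forall y in X, forall y' in X, e w y ==> e w y' ==> (y == y')].
have [/existsP[w /andP[wX lw]]|] := boolP [exists w in X, leaf w].
  exists w => // y y' yX y'X wy wy'.
  by move: lw => /forall_inP/(_ y yX)/forall_inP/(_ y' y'X); rewrite wy wy' => /eqP.
rewrite negb_exists => /forallP noleaf.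
have next w p : w \in X -> exists2 y, (y \in X) && e w y & y != p.
  move=> wX; have := noleaf w; rewrite wX /= negb_forall => /existsP[y].
  rewrite negb_imply negb_forall => /andP[yX /existsP[y']].
  rewrite !negb_imply => /and4P[y'X wy wy' ne].
  have [eyp|nyp] := eqVneq y p; last by exists y => //; rewrite yX.
  by exists y'; rewrite ?y'X // -eyp eq_sym.
have long m : exists x s, [/\ x \in X, path (induced e X) x s, uniq (x :: s) & size s = m].
  elim: m => [|m [x [s [xX ps us szs]]]].
    by case/set0Pn: X0 => x xX; exists x, [::].
  (* The path grows at its head, so [head x s] is the vertex visited just before [x]; for the
     one-vertex path it is [x] itself and excludes nothing. *)
  have [y /andP[yX xy] yh] := next x (head x s) xX.
  have yx : induced e X y x by rewrite /induced /= yX xX e_sym.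
  have [ys|ys] := boolP (y \in x :: s); last first.
    by exists y, (x :: s); split=> //; rewrite ?cons_uniq ?ys //= ?szs // ps andbT.
  move: ys; rewrite inE eq_sym (negPf (edge_neq xy)) /= => ys.
  case/splitPr: ys ps us yh szs => s1 s2; rewrite cat_path => /andP[ps1 /= /andP[l1y _]].
  rewrite cat_uniq /= => us yh _.
  have := F (x :: rcons s1 y); rewrite /= size_rcons.
  case: s1 ps1 l1y us yh => [|z s1] ps1 l1y us yh; first by rewrite eqxx in yh.
  suff C : ucycle (induced e X) (x :: rcons (z :: s1) y) by move=> /(_ C).
  have pc : path (induced e X) x (rcons (rcons (z :: s1) y) x).
    by rewrite rcons_path last_rcons yx rcons_path ps1 l1y.
  apply/andP; split; first exact: pc.
  case/and4P: us; rewrite mem_cat negb_or => /andP[xs _] us1.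
  rewrite negb_or => /andP[ys _] _.
  rewrite cons_uniq rcons_uniq mem_rcons in_cons negb_or xs us1 ys edge_neq //.
have [x [s [_ _ us szs]]] := long #|V|.
have := max_card (mem (x :: s)); rewrite (card_uniqP us) /= szs.
by rewrite ltnn.
Qed.

Lemma edges_in_setD1 w u X :
  (forall y, y \in X -> e w y -> y = u) -> w \in X -> u \in X -> e w u ->
  edges_in X = [set w; u] |: edges_in (X :\ w).
Proof.
move=> nbr wX uX wu; apply/setP => A; rewrite in_setU1.
have [->|ne] := eqVneq A [set w; u]; first by rewrite edges_inE // wX uX.
apply/idP/idP => [AX|]; last first.
  by rewrite !inE subsetD1 => /andP[-> /andP[]].
have [wA|wA] := boolP (w \in A).
  have [y [eA wy _ yX]] := edges_in_of wA AX.
  by rewrite eA (nbr y) ?eqxx // in ne.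
by move: AX; rewrite !inE subsetD1 wA andbT.
Qed.

Lemma edges_in_isolated w X :
  (forall y, y \in X -> ~~ e w y) -> edges_in X = edges_in (X :\ w).
Proof.
move=> nbr; apply/setP => A; apply/idP/idP => [AX|]; last first.
  by rewrite !inE subsetD1 => /andP[-> /andP[]].
have [wA|wA] := boolP (w \in A).
  have [y [_ wy _ yX]] := edges_in_of wA AX.
  by rewrite (negPf (nbr y yX)) in wy.
by move: AX; rewrite !inE subsetD1 wA andbT.
Qed.

Lemma unsplit_setD1 w L X : unsplit L X -> unsplit (L :\ w) (X :\ w).
Proof.
move=> /forall_inP us; apply/forall_inP => A; rewrite inE subsetD1.
move=> /andP[Ae /andP[AX wA]].
have /us/orP[dAL|AL] : A \in edges_in X by rewrite inE Ae.
  by rewrite (disjointWr _ dAL) // subD1set.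
by rewrite subsetD1 AL wA orbT.
Qed.

(** Remove a vertex [w] of degree at most one. If it has a neighbour, the roots of the rest also
    reach [w] and one edge is gained; if it is isolated, it becomes a root itself. *)
Lemma forest_roots X : forest (induced e X) ->
  exists N, [/\ N \subset X, hits N X & #|N| + #|edges_in X| = #|X|].
Proof.
elim: {X}#|X| {-2}X (erefl #|X|) => [|m IH] X cX F.
  have -> : X = set0 by apply/eqP; rewrite -cards_eq0 cX.
  exists set0; split; rewrite ?sub0set //.
    apply/forallP => L; apply/implyP => /and3P[_ L0 _].
    by rewrite eqEsubset L0 sub0set.
  rewrite !cards0; apply/eqP; rewrite cards_eq0 -subset0; apply/subsetP => A.
  rewrite inE => /andP[/card_edge cA]; rewrite subset0 => /eqP eA.
  by rewrite eA cards0 in cA.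
have X0 : X != set0 by rewrite -cards_eq0 cX.
have [w wX leaf] := exists_leaf X0 F.
have cXw : #|X :\ w| = m by move: cX; rewrite (cardsD1 w X) wX => -[].
have [N [NX hitN cN]] := IH _ cXw (forest_sub (subD1set X w) F).
have wN : w \notin N.
  by apply/negP => /(subsetP NX); rewrite !inE eqxx.
have NX' : N \subset X by apply: subset_trans NX (subD1set _ _).
have hitw L : N \subset L -> L \subset X -> unsplit L X -> L :\ w = X :\ w.
  move=> NL LX us; apply/eqP; move/forallP/(_ (L :\ w)): hitN => /implyP; apply.
  by rewrite subsetD1 NL wN setSD // unsplit_setD1.
have hitX N' : N \subset N' ->
    (forall L, N' \subset L -> unsplit L X -> L :\ w = X :\ w -> w \in L) ->
    hits N' X.
  move=> NN' HL; apply/forallP => L; apply/implyP => /and3P[N'L LX us].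
  have eL := hitw L (subset_trans NN' N'L) LX us.
  have wL := HL L N'L us eL.
  by rewrite -(setD1K wL) eL setD1K.
have [/existsP[u /andP[uX wu]]|] := boolP [exists u in X, e w u].
  have nbr y : y \in X -> e w y -> y = u by move=> yX wy; apply: leaf.
  exists N; split=> //.
    apply: hitX => // L NL /forall_inP us eL.
    have uL : u \in L.
      have : u \in X :\ w by rewrite !inE eq_sym edge_neq.
      by rewrite -eL inE => /andP[].
    have /us : [set w; u] \in edges_in X by rewrite edges_inE // wX.
    rewrite -setI_eq0 => /orP[/eqP/setP/(_ u)|].
      by rewrite !inE eqxx orbT uL.
    by rewrite subUset !sub1set => /andP[].
  rewrite (edges_in_setD1 nbr) // cardsU1 edges_inE // !inE eqxx /=.
  by rewrite addnCA cN cXw cX.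
rewrite negb_exists => /forallP iso.
have {}iso y : y \in X -> ~~ e w y by move=> yX; have := iso y; rewrite yX.
exists (w |: N); split.
- by rewrite subUset sub1set wX.
- by apply: hitX; [exact: subsetUr | move=> L + _ _; rewrite subUset sub1set => /andP[]].
- by rewrite (edges_in_isolated iso) cardsU1 wN -addnA cN cXw cX.
Qed.

(** * Perfect matchings of a forest *)

Definition perfect M X : bool :=
  [&& M \subset edges_in X, trivIset M & cover M == X].

Lemma perfect_setD1 M X A : perfect M X -> A \in M -> perfect (M :\ A) (X :\: A).
Proof.
move=> /and3P[ME tM /eqP cM] AM.
have disj B : B \in M -> B != A -> [disjoint B & A].
  by move=> BM ne; apply: (trivIsetP tM).
apply/and3P; split.
- apply/subsetP => B; rewrite in_setD1 => /andP[ne BM]; rewrite inE subsetD.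
  by have /(subsetP ME) := BM; rewrite inE => /andP[-> ->]; apply: disj.
- by apply: trivIsetS tM; apply: subD1set.
apply/eqP/setP => x; rewrite inE -cM; apply/bigcupP/andP.
  move=> [B]; rewrite !inE => /andP[ne BM] xB; split; last by apply/bigcupP; exists B.
  by apply: contraTN xB => xA; rewrite (disjointFl (disj B BM ne)).
move=> [xA /bigcupP[B BM xB]]; exists B => //.
by rewrite !inE BM andbT; apply: contraNneq xA => <-.
Qed.

(** A leaf has only one possible partner, so both matchings contain its edge; delete the two ends
    and repeat. This keeps the monomial of a solution from cancelling modulo 2. *)
Lemma forest_perfect_unique X M1 M2 : forest (induced e X) ->
  perfect M1 X -> perfect M2 X -> M1 = M2.
Proof.
have [m] := ubnP #|X|; elim: m X M1 M2 => // m IH X M1 M2 ltX F P1 P2.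
have [X0|X0] := eqVneq X set0.
  have M0 M : perfect M X -> M = set0.
    move=> /and3P[ME _ _]; apply/eqP; rewrite -subset0; apply/subsetP => A AM.
    have := subsetP ME A AM; rewrite inE X0 subset0 => /andP[/card_edge + /eqP eA].
    by rewrite eA cards0.
  by rewrite (M0 M1) // (M0 M2).
have [w wX leaf] := exists_leaf X0 F.
have mate M : perfect M X -> exists u, [/\ [set w; u] \in M, u \in X & e w u].
  move=> /and3P[ME _ /eqP cM]; move: wX; rewrite -{1}cM => /bigcupP[A AM wA].
  have [u [eA wu _ uX]] := edges_in_of wA (subsetP ME A AM).
  by exists u; rewrite -eA.
have [u1 [A1 u1X wu1]] := mate M1 P1; have [u2 [A2 u2X wu2]] := mate M2 P2.
have eu := leaf u1 u2 u1X u2X wu1 wu2; subst u2.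
rewrite -(setD1K A1) -(setD1K A2); congr (_ |: _).
apply: (IH (X :\: [set w; u1])).
- apply: leq_trans (_ : #|X| <= m) => //; apply: proper_card.
  apply/properP; split; first exact: subsetDl.
  by exists w => //; rewrite !inE eqxx.
- exact: forest_sub (subsetDl _ _) F.
- exact: perfect_setD1.
- exact: perfect_setD1.
Qed.

(** This is the first summand of D: a cover is at most as large as the sum of the sizes of its
    members, with equality exactly for disjoint members. *)
Lemma card_cover_edges M X : M \subset edges_in X -> cover M = X ->
  #|X| <= 2 * #|M| /\ ((#|X| == 2 * #|M|) = perfect M X).
Proof.
move=> ME cM; have sM : \sum_(A in M) #|A| = 2 * #|M|.
  rewrite mulnC -sum_nat_const; apply: eq_bigr => A AM; apply: card_edge.
  by have := subsetP ME A AM; rewrite inE => /andP[].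
have [] := leq_card_cover M; rewrite sM cM => -> ->; split=> //.
by rewrite /perfect ME cM eqxx andbT.
Qed.

End Forests.

(** * Tree decompositions *)

Section Addresses.

Variable V : finType.
Implicit Types (t u : ntd V) (v : V) (a p q : seq bool).

Lemma prefix_rcons_or a q b : prefix a (rcons q b) -> a = rcons q b \/ prefix a q.
Proof.
case/prefixP => r; case/lastP: r => [|r z]; first by rewrite cats0; left.
rewrite -rcons_cat => /rcons_inj[-> _]; right; exact: prefix_prefix.
Qed.

(* A path can leave the subtree at address [a] only through [a]. *)
Lemma exit_prefix a p s : path tree_adj p s -> prefix a p ->
  ~~ prefix a (last p s) -> a \in p :: s.
Proof.
elim: s p => [|q s IH] p /=; first by move=> _ ->.
case/andP => pq ps ap nl; rewrite inE; have [aq|aq] := boolP (prefix a q).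
  by rewrite (IH q) ?orbT.
apply/orP; left; move: pq; rewrite /tree_adj /= => pq.
have qp b : q = rcons p b -> False.
  by move=> eq; case/negP: aq; rewrite eq; apply: prefix_trans ap (prefix_rcons _ _).
have pq' b : p = rcons q b -> a == p.
  by move=> ep; move: ap; rewrite ep => /prefix_rcons_or[->|]; rewrite ?(negPf aq).
by case/or4P: pq => /eqP; [move/qp | move/qp | move/pq' | move/pq'].
Qed.

Lemma subtree_cat t a p :
  subtree t (a ++ p) = obind (fun u => subtree u p) (subtree t a).
Proof.
elim: a t => [|b a IH] t /=; first by case: t p => [|? ?|? ?|? ?] [|[] p].
by case: b; case: t.
Qed.

Lemma in_bag_cat t u a p v : subtree t a = Some u ->
  in_bag t v (a ++ p) = in_bag u v p.
Proof. by move=> H; rewrite /in_bag subtree_cat H. Qed.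

Lemma in_bag_root t v : in_bag t v [::] = (v \in bag t).
Proof. by case: t. Qed.

Fixpoint forgotten t : seq V :=
  match t with
  | Leaf => [::]
  | Introduce _ u => forgotten u
  | Forget v u => v :: forgotten u
  | Join u1 u2 => forgotten u1 ++ forgotten u2
  end.

(** All that variable elimination needs from connectivity: no vertex is forgotten twice, and none
    returns once it has been forgotten. *)
Fixpoint separated t : bool :=
  match t with
  | Leaf => true
  | Introduce v u => (v \notin forgotten u) && separated u
  | Forget _ u => separated u
  | Join u1 u2 =>
      [&& ~~ has [in forgotten u1] (forgotten u2), separated u1 & separated u2]
  end.

Lemma forgotten_in_bag t v : nice t -> v \in forgotten t -> exists p, in_bag t v p.
Proof.
elim: t => [|w u IH|w u IH|u1 IH1 u2 IH2] //=.
- by case/andP=> _ nu /(IH nu)[p vp]; exists (false :: p).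
- case/andP=> wu nu; rewrite inE => /orP[/eqP->|/(IH nu)[p vp]].
    by exists [:: false]; rewrite -[[:: false]]cats0 /in_bag /=; case: (u) wu.
  by exists (false :: p).
case/and3P=> _ n1 n2; rewrite mem_cat => /orP[/(IH1 n1)|/(IH2 n2)] [p vp].
  by exists (false :: p).
by exists (true :: p).
Qed.

Lemma forgotten_notin_bag t v : nice t -> separated t ->
  v \in forgotten t -> v \notin bag t.
Proof.
elim: t => [|w u IH|w u IH|u1 IH1 u2 IH2] //=.
- case/andP=> wu nu /andP[wf su] vf; rewrite in_setU1 negb_or IH // andbT.
  by apply: contraNneq wf => <-.
- case/andP=> wu nu su; rewrite inE in_setD1 negb_and negbK.
  by case/orP=> [->//|/(IH nu su)->]; rewrite orbT.
- case/and3P=> /eqP eb n1 n2 /and3P[_ s1 s2]; rewrite mem_cat.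
  by case/orP=> [/(IH1 n1 s1)|/(IH2 n2 s2)] //; rewrite eb.
Qed.

(** A violation gives a vertex with one bag inside the subtree of a child and one outside. The
    connecting path passes the root of that child, whose bag would then contain the vertex; but it
    was not yet introduced there, or already forgotten. *)
Lemma connected_separated t0 a t :
  (forall v p q, in_bag t0 v p -> in_bag t0 v q ->
     exists s, [&& path tree_adj p s, last p s == q & all (in_bag t0 v) s]) ->
  subtree t0 a = Some t -> nice t -> separated t.
Proof.
move=> conn.
have through c v p q : in_bag t0 v (c ++ p) -> in_bag t0 v q -> ~~ prefix c q ->
    in_bag t0 v c.
  move=> vp vq ncq; have [s /and3P[ps /eqP ls als]] := conn _ _ _ vp vq.
  have := exit_prefix ps (prefix_prefix _ _); rewrite ls => /(_ ncq).
  by rewrite inE => /orP[/eqP->//|/(allP als)].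
elim: t a => [|w u IH|w u IH|u1 IH1 u2 IH2] a //= ta.
- have ua : subtree t0 (a ++ [:: false]) = Some u by rewrite subtree_cat ta /=; case: (u).
  case/andP=> wu nu; rewrite (IH _ ua nu) andbT; apply: contra wu => wf.
  have [p wp] := forgotten_in_bag nu wf.
  rewrite -in_bag_root -(in_bag_cat _ _ ua) cats0.
  apply: (through _ _ p a); first by rewrite (in_bag_cat _ _ ua).
    by rewrite -[a]cats0 (in_bag_cat _ _ ta) in_bag_root /= setU11.
  by apply/negP => /size_prefix; rewrite size_cat /= addn1 ltnn.
- have ua : subtree t0 (a ++ [:: false]) = Some u by rewrite subtree_cat ta /=; case: (u).
  by case/andP=> _ nu; apply: (IH _ ua nu).
have ua1 : subtree t0 (a ++ [:: false]) = Some u1 by rewrite subtree_cat ta /=; case: (u1).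
have ua2 : subtree t0 (a ++ [:: true]) = Some u2 by rewrite subtree_cat ta /=; case: (u2).
case/and3P=> eb n1 n2; rewrite (IH1 _ ua1 n1) (IH2 _ ua2 n2) !andbT.
apply/hasPn => v vf2; apply/negP => /= vf1.
case/negP: (forgotten_notin_bag n1 (IH1 _ ua1 n1) vf1).
have [p vp] := forgotten_in_bag n1 vf1; have [q vq] := forgotten_in_bag n2 vf2.
rewrite -in_bag_root -(in_bag_cat _ _ ua1) cats0.
apply: (through _ _ p ((a ++ [:: true]) ++ q)).
- by rewrite (in_bag_cat _ _ ua1).
- by rewrite (in_bag_cat _ _ ua2).
- by rewrite -catA prefix_catr // eqxx /=; case: q vq.
Qed.

Lemma in_bag_cases t v p : nice t -> in_bag t v p -> v \in bag t \/ v \in forgotten t.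
Proof.
elim: t p => [|w u IH|w u IH|u1 IH1 u2 IH2] p nt;
  case: p => [|b p]; rewrite ?in_bag_root; try by left.
- by case: b.
- case/andP: nt => _ nu; case: b => // vp.
  have [vu|vf] := IH p nu vp; [left|by right].
  by rewrite in_setU1 vu orbT.
- case/andP: nt => _ nu; case: b => // vp.
  have [vu|vf] := IH p nu vp; last by right; rewrite inE vf orbT.
  have [->|ne] := eqVneq v w; first by right; rewrite inE eqxx.
  by left; rewrite in_setD1 ne.
case/and3P: nt => /eqP eb n1 n2; rewrite mem_cat.
case: b => vp.
  by have [vu|vf] := IH2 p n2 vp; [left; rewrite /= eb | right; rewrite vf orbT].
by have [vu|vf] := IH1 p n1 vp; [left | right; rewrite vf].
Qed.

Lemma uniq_forgotten t : nice t -> separated t -> uniq (forgotten t).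
Proof.
elim: t => [|w u IH|w u IH|u1 IH1 u2 IH2] //=.
- by case/andP=> _ nu /andP[_ su]; apply: IH.
- case/andP=> wu nu su; rewrite IH // andbT.
  by apply: contraL wu => /(forgotten_notin_bag nu su).
by case/and3P=> _ n1 n2 /and3P[d s1 s2]; rewrite cat_uniq IH1 // IH2 // andbT.
Qed.

Variables (e : rel V).
Hypotheses (e_sym : symmetric e) (e_irr : irreflexive e).

(* The edges multiplied in at a node that forgets one of their ends. *)
Fixpoint counted t : seq {set V} :=
  match t with
  | Leaf => [::]
  | Introduce _ u => counted u
  | Forget v u =>
      [seq [set v; w] | w <- enum [pred w in bag u :\ v | e v w]] ++ counted u
  | Join u1 u2 => counted u1 ++ counted u2
  end.

Lemma counted_ends t A : nice t -> A \in counted t -> exists x y,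
  [/\ A = [set x; y], e x y, x \in forgotten t & (y \in forgotten t) || (y \in bag t)].
Proof.
elim: t => [|w u IH|w u IH|u1 IH1 u2 IH2] //=.
- case/andP=> _ nu /(IH nu)[x [y [-> exy xf yf]]]; exists x, y; split=> //.
  by case/orP: yf => [->//|yb]; rewrite in_setU1 yb !orbT.
- case/andP=> _ nu; rewrite mem_cat => /orP[/mapP[y]|/(IH nu)[x [y [-> exy xf yf]]]].
    rewrite mem_enum inE => /andP[yb wy] ->; exists w, y; split=> //.
      by rewrite mem_head.
    by rewrite yb orbT.
  exists x, y; split=> //; first by rewrite inE xf orbT.
  rewrite in_cons in_setD1; have [//|ne] := eqVneq y w; exact: yf.
case/and3P=> /eqP eb n1 n2; rewrite mem_cat => /orP[/(IH1 n1)|/(IH2 n2)] [x [y [-> exy xf yf]]]; exists x, y;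
  rewrite !mem_cat xf ?orbT; split=> //.
  by case/orP: yf => ->; rewrite ?orbT.
by case/orP: yf => [->|]; rewrite ?orbT // -eb => ->; rewrite orbT.
Qed.

(** An edge counted below has a forgotten end, which is in no later bag and is neither forgotten nor
    in a bag on the other side of a join; so the edge cannot be counted again. *)
Lemma uniq_counted t : nice t -> separated t -> uniq (counted t).
Proof.
elim: t => [|w u IH|w u IH|u1 IH1 u2 IH2] //=.
- by case/andP=> _ nu /andP[_ su]; apply: IH.
- case/andP=> wu nu su; rewrite cat_uniq IH // andbT map_inj_in_uniq ?enum_uniq.
    apply/hasPn => A /(counted_ends nu)[x [y [-> exy xf _]]]; apply/mapP => -[z].
    rewrite mem_enum inE => /andP[/setD1P[_ zu] _] exz.
    have xwz : x \in [set w; z] by rewrite -exz !inE eqxx.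
    case/negP: (forgotten_notin_bag nu su xf).
    by move: xwz; rewrite !inE => /orP[]/eqP->.
  move=> y z; rewrite !mem_enum !inE => /andP[_ wy] /andP[_ wz].
  by apply: set2_inj; apply: edge_neq wy.
case/and3P=> /eqP eb n1 n2 /and3P[d s1 s2]; rewrite cat_uniq IH1 // IH2 // andbT.
apply/hasPn => A /(counted_ends n2)[x [y [-> exy xf2 yf2]]].
apply/negP => /(counted_ends n1)[x' [y' [eA _ xf1 _]]].
have : x' \in [set x; y] by rewrite eA !inE eqxx.
have nf2 : x' \notin forgotten u2.
  by apply: contraTN xf1 => xf; apply: (hasPn d).
have nb2 : x' \notin bag u2 by rewrite -eb (forgotten_notin_bag n1 s1).
rewrite !inE => /orP[]/eqP ex; subst x'; first by rewrite xf2 in nf2.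
by move: yf2; rewrite (negPf nf2) (negPf nb2).
Qed.

Lemma bag_edge_counted t x y p : nice t -> e x y ->
  in_bag t x p -> in_bag t y p ->
  [set x; y] \in counted t \/ (x \in bag t) && (y \in bag t).
Proof.
move=> + exy; elim: t p => [|w u IH|w u IH|u1 IH1 u2 IH2] p nt;
  case: p => [|b p]; rewrite ?in_bag_root; try by move=> -> ->; right.
- by case: b.
- case/andP: nt => _ nu; case: b => // xp yp.
  have [|/andP[xb yb]] := IH p nu xp yp; [by left | right].
  by rewrite /= !in_setU1 xb yb !orbT.
- case/andP: nt => _ nu; case: b => // xp yp.
  have [c|/andP[xb yb]] := IH p nu xp yp; first by left; rewrite mem_cat c orbT.
  have nxy := edge_neq e_irr exy.
  have [ex|nx] := eqVneq x w.
    left; rewrite mem_cat; apply/orP; left; apply/mapP; exists y; last by rewrite ex.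
    by rewrite mem_enum inE -ex exy in_setD1 yb eq_sym nxy.
  have [ey|ny] := eqVneq y w; last by right; rewrite /= !in_setD1 nx ny xb yb.
  left; rewrite mem_cat; apply/orP; left; apply/mapP; exists x; last by rewrite ey setUC.
  by rewrite mem_enum inE -ey e_sym exy in_setD1 xb nxy.
case/and3P: nt => /eqP eb n1 n2; case: b => xp yp /=; rewrite mem_cat.
  have [->|] := IH2 p n2 xp yp; first by left; rewrite orbT.
  by rewrite eb; right.
by have [->|] := IH1 p n1 xp yp; [left | right].
Qed.

(** The root bag is empty, so every vertex met in some bag has been forgotten and every edge
    contained in some bag has been counted. *)
Lemma decomposition_forgotten t : nice_tree_decomposition e t ->
  [/\ separated t, forall v, v \in forgotten t & counted t =i edges e].
Proof.
case=> nt b0 [cov covE conn].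
have st : separated t by apply: (connected_separated conn (a := [::])) nt; case: (t).
split=> // [v|A].
  have [p vp] := cov v; have [|//] := in_bag_cases nt vp.
  by rewrite b0 inE.
apply/idP/edgesP => [/(counted_ends nt)[x [y [-> exy _ _]]]|[x [y [-> exy]]]].
  by exists x, y.
have [p /andP[xp yp]] := covE x y exy.
by have [//|] := bag_edge_counted nt exy xp yp; rewrite b0 inE.
Qed.

End Addresses.

Import GRing.Theory Num.Theory.
Local Open Scope ring_scope.

(** * Counting modulo 2 *)

Lemma prod_addr (I : finType) (R : comNzRingType) (A : {set I}) (F G : I -> R) :
  \prod_(i in A) (F i + G i) =
  \sum_(J : {set I} | J \subset A) (\prod_(i in J) F i) * \prod_(i in A :\: J) G i.
Proof.
pose F' i := if i \in A then F i else 0.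
pose G' i := if i \in A then G i else 1.
have -> : \prod_(i in A) (F i + G i) = \prod_i (F' i + G' i).
  rewrite big_mkcond; apply: eq_bigr => i _; rewrite /F' /G'.
  by case: ifP; rewrite // add0r.
rewrite bigA_distr (bigID (fun J : {set I} => J \subset A)) /= [X in _ + X]big1.
  rewrite addr0; apply: eq_bigr => J JA.
  rewrite (bigID [in J]) /=; congr (_ * _).
    apply: eq_bigr => i iJ; rewrite iJ /F' (subsetP JA) //.
  under eq_bigr => i iJ do rewrite (negPf iJ).
  by rewrite -big_mkcondr; apply: eq_bigl => i; rewrite inE.
move=> J /subsetPn[i iJ iA]; rewrite (bigD1 i) //= iJ /F' (negPf iA).
by rewrite mul0r.
Qed.

Section CharacteristicTwo.

Variables (V : finType) (e : rel V) (R : comNzRingType).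
Hypotheses (e_sym : symmetric e) (e_irr : irreflexive e).
Hypothesis char2 : forall x : R, x + x = 0.
Implicit Types (X L N C : {set V}) (M : {set {set V}}).

Definition symdiff L C := (L :\: C) :|: (C :\: L).

Lemma in_symdiff v L C : (v \in symdiff L C) = (v \in L) (+) (v \in C).
Proof. by rewrite !inE; case: (v \in L); case: (v \in C). Qed.

Lemma symdiffK C : involutive (symdiff^~ C).
Proof. by move=> L; apply/setP => v; rewrite !in_symdiff addbK. Qed.

(** The symmetric difference with a nonempty set is an involution without fixed points, and paired
    terms cancel. *)
Lemma sum_symdiff C (F : {set V} -> R) : C != set0 ->
  (forall L, F (symdiff L C) = F L) -> \sum_L F L = 0.
Proof.
case/set0Pn => v vC FC; rewrite (bigID (fun L => v \in L)) /=.
rewrite [X in _ + X](reindex_inj (inv_inj (symdiffK C))) /=.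
have -> : \sum_(L : {set V} | v \notin symdiff L C) F (symdiff L C)
        = \sum_(L : {set V} | v \in L) F L.
  by apply: eq_big => L // ; rewrite in_symdiff vC addbT negbK.
exact: char2.
Qed.

(** The number of summands is [2 ^ #|X :\: C|], which is odd only for [C = X]. *)
Lemma sum_supersets C X : C \subset X ->
  \sum_(Y : {set V} | (C \subset Y) && (Y \subset X)) (1 : R) = (C == X)%:R.
Proof.
move=> CX; have [->|ne] := eqVneq C X.
  rewrite (big_pred1 X) // => Y.
  by rewrite /= eqEsubset andbC.
have /properP[_ [v vX vC]] : C \proper X by rewrite properEneq ne.
rewrite big_mkcond; apply: (sum_symdiff (C := [set v])).
  by apply/set0Pn; exists v; rewrite inE.
move=> Y; congr (if _ then _ else _); congr (_ && _).
  apply/subsetP/subsetP => H u uC; have := H u uC; rewrite in_symdiff inE;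
    by rewrite (_ : (u == v) = false) ?addbF //; apply: contraNF vC => /eqP <-.
apply/subsetP/subsetP => H u; have := H u; rewrite in_symdiff inE;
  by have [->|_] := eqVneq u v; rewrite ?addbF // vX.
Qed.

(** The sets [L] are the unions of components of G[X] that include all components meeting [N]. Their
    number is a power of two, equal to 1 exactly when [N] misses no component. *)
Lemma sum_unsplit N X : N \subset X ->
  \sum_(L : {set V} | [&& N \subset L, L \subset X & unsplit e L X]) (1 : R)
    = (hits e N X)%:R.
Proof.
move=> NX; have [hit|] := boolP (hits e N X).
  rewrite (big_pred1 X) // => L /=.
  apply/idP/eqP => [H|->]; first by apply/eqP; move/forallP/(_ L): hit; rewrite H.
  rewrite NX subxx; apply/forall_inP => A; rewrite inE => /andP[_ ->].
  by rewrite orbT.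
(* The involution [L |-> L + (X \ L0)] of the summation range has no fixed point. *)
rewrite negb_forall => /existsP[L0]; rewrite negb_imply => /andP[/and3P[NL0 L0X us0] ne].
rewrite big_mkcond; apply: (sum_symdiff (C := X :\: L0)).
  apply/set0Pn; have /properP[_ [v vX vL]] : L0 \proper X by rewrite properEneq ne.
  by exists v; rewrite inE vL.
suff imp L : [&& N \subset L, L \subset X & unsplit e L X] ->
    [&& N \subset symdiff L (X :\: L0), symdiff L (X :\: L0) \subset X
      & unsplit e (symdiff L (X :\: L0)) X].
  move=> L; congr (if _ then _ else _); apply/idP/idP; last exact: imp.
  by move/imp; rewrite symdiffK.
case/and3P=> NL LX us; apply/and3P; split.
- apply/subsetP => v vN; rewrite in_symdiff inE (subsetP NL) //.
  by rewrite (subsetP NL0).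
- apply/subsetP => v; rewrite in_symdiff inE.
  by case: (boolP (v \in L)) => [/(subsetP LX)->|_ /andP[]].
apply/forall_inP => A AE.
have AX : A \subset X by move: AE; rewrite inE => /andP[].
have {us} := forall_inP us A AE; have {us0} := forall_inP us0 A AE.
case/orP=> [d0|s0]; case/orP=> [d|s].
- apply/orP; right; apply/subsetP => v vA.
  by rewrite in_symdiff inE (disjointFr d0 vA) (disjointFr d vA) (subsetP AX).
- apply/orP; left; rewrite disjoint_sym disjoint_subset; apply/subsetP => v.
  rewrite in_symdiff !inE => H; apply/negP => vA; move: H.
  by rewrite (disjointFr d0 vA) (subsetP s) // (subsetP AX).
- apply/orP; left; rewrite disjoint_sym disjoint_subset; apply/subsetP => v.
  rewrite in_symdiff !inE => H; apply/negP => vA; move: H.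
  by rewrite (disjointFr d vA) (subsetP s0).
- apply/orP; right; apply/subsetP => v vA.
  by rewrite in_symdiff inE (subsetP s) // (subsetP s0).
Qed.

Definition mono (x y : V -> R) X N : R :=
  (\prod_(v in N) y v) * \prod_(v in X :\: N) x v.

(** Expanding the product over [L] selects the roots [N] among the vertices of that side. After
    exchanging the sums, the sides compatible with [N] are counted modulo 2. *)
Lemma sum_sides (x y : V -> R) c X :
  \sum_(L : {set V} | (L \subset X) && unsplit e L X)
     (\prod_(v in L) (c * y v + x v)) * \prod_(v in X :\: L) x v
  = \sum_(N : {set V} | (N \subset X) && hits e N X) c ^+ #|N| * mono x y X N.
Proof.
transitivity (\sum_(L : {set V} | (L \subset X) && unsplit e L X)
    \sum_(N : {set V} | N \subset L) c ^+ #|N| * (\prod_(v in N) y v *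
      (\prod_(v in L :\: N) x v * \prod_(v in X :\: L) x v))).
  apply: eq_bigr => L _; rewrite prod_addr mulr_suml; apply: eq_bigr => N _.
  by rewrite big_split prodr_const /= -!mulrA.
rewrite (exchange_big_dep (fun N : {set V} => N \subset X)) /=; last first.
  by move=> L N /andP[LX _] NL; apply: subset_trans LX.
rewrite [RHS]big_mkcondr; apply: eq_bigr => N NX.
transitivity (\sum_(L : {set V} | [&& N \subset L, L \subset X & unsplit e L X])
    1 * (c ^+ #|N| * mono x y X N)); last first.
  by rewrite -mulr_suml sum_unsplit //; case: (hits e N X); rewrite ?mul1r ?mul0r.
apply: eq_big => [L|L]; first by rewrite andbC.
case/andP=> /andP[LX _] NL; rewrite mul1r /mono; congr (_ * (_ * _)).
rewrite [RHS](big_setID (L :\: N)) /=; congr (_ * _); apply: eq_bigl => v.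
  rewrite !inE; case: (boolP (v \in L)) => [/(subsetP LX)->|];
    by rewrite ?andbF ?andbT ?andbb.
rewrite !inE; case: (boolP (v \in N)) => [/(subsetP NL)->|] //=.
Qed.

(** Expanding the product selects an edge set [M] whose ends are all marked. The marks [Y] then
    range between [cover M] and [X], and their number is odd only if [M] covers [X]. *)
Lemma sum_matchings d X :
  \sum_(Y : {set V} | Y \subset X)
     \prod_(A in edges_in e X) (if A \subset Y then d + 1 else 1)
  = \sum_(M : {set {set V}} | (M \subset edges_in e X) && (cover M == X)) d ^+ #|M| :> R.
Proof.
transitivity (\sum_(Y : {set V} | Y \subset X)
    \sum_(M : {set {set V}} | M \subset edges_in e X)
      if cover M \subset Y then d ^+ #|M| else 0).
  apply: eq_bigr => Y _.
  have -> : \prod_(A in edges_in e X) (if A \subset Y then d + 1 else 1)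
      = \prod_(A in edges_in e X) ((if A \subset Y then d else 0) + 1).
    by apply: eq_bigr => A _; case: ifP; rewrite ?add0r.
  rewrite prod_addr; apply: eq_bigr => M ME; rewrite [X in _ * X]big1 // mulr1.
  case: ifP => [/bigcupsP cY|/negbT/subsetPn[v /bigcupP[A AM vA] vY]].
    by rewrite -prodr_const; apply: eq_bigr => A AM; rewrite cY.
  rewrite (bigD1 A) //= ifF ?mul0r //.
  by apply: contraNF vY => /subsetP; apply.
rewrite exchange_big /= [RHS]big_mkcondr; apply: eq_bigr => M ME.
have cX : cover M \subset X.
  by apply/bigcupsP => A /(subsetP ME); rewrite inE => /andP[].
transitivity (\sum_(Y : {set V} | (cover M \subset Y) && (Y \subset X)) 1 * d ^+ #|M|).
  by rewrite -big_mkcondr /=; apply: eq_big => Y; rewrite ?mul1r // andbC.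
by rewrite -mulr_suml sum_supersets //; case: (cover M == X); rewrite ?mul1r ?mul0r.
Qed.

End CharacteristicTwo.

(** * The partition function *)

Lemma polyb_char2 (p : {poly bool}) : p + p = 0.
Proof. by apply/polyP => i; rewrite coefD coef0; case: p`_i. Qed.

Section PartitionFunction.

Variables (V : finType) (e : rel V).
Hypotheses (e_sym : symmetric e) (e_irr : irreflexive e).
Variables (kp k : nat) (x y : V -> {poly bool}).
Implicit Types (X L N Y : {set V}) (M : {set {set V}}) (A : {set V}).

(** The weight of an uncovered vertex provides the term -2|X| of D up to the constant 2|V|, so that
    no negative exponent occurs. Only one side carries the y_v: roots are chosen in [L]. *)
Definition vertex_weight (s : vstate) (v : V) : {poly bool} :=
  match s with
  | None => 'X^k * 'X^k
  | Some (l, _) => 'X^kp * (if l then x v + 'X^k * y v else x v)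
  end.

Definition pair_weight (s s' : vstate) : {poly bool} :=
  match s, s' with
  | Some (l, a), Some (l', b) =>
      if l (+) l' then 0
      else 'X^k * (if a && b then 1 + 'X^k * 'X^k else 1)
  | _, _ => 1
  end.

Definition covered (tau : {ffun V -> vstate}) := [set v | tau v != None].
Definition left_side (tau : {ffun V -> vstate}) :=
  [set v | if tau v is Some (l, _) then l else false].
Definition marked (tau : {ffun V -> vstate}) :=
  [set v | if tau v is Some (_, a) then a else false].

Definition edge_weight (tau : {ffun V -> vstate}) (A : {set V}) : {poly bool} :=
  if A \subset covered tau then
    if [disjoint A & left_side tau] || (A \subset left_side tau) then
      'X^k * (if A \subset marked tau then 'X^k * 'X^k + 1 else 1)
    else 0
  else 1.

Definition partition_function : {poly bool} :=
  \sum_(tau : {ffun V -> vstate})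
    (\prod_v vertex_weight (tau v) v) * \prod_(A in edges e) edge_weight tau A.

Lemma edge_weight2 tau u v : edge_weight tau [set u; v] = pair_weight (tau u) (tau v).
Proof.
rewrite /edge_weight disjoints_subset !subUset !sub1set !inE.
by case: (tau u) => [[[] []]|]; case: (tau v) => [[[] []]|]; rewrite //= addrC.
Qed.

Definition config X L Y : {ffun V -> vstate} :=
  [ffun v => if v \in X then Some (v \in L, v \in Y) else None].

Lemma sum_config (F : {ffun V -> vstate} -> {poly bool}) :
  \sum_tau F tau = \sum_(X : {set V}) \sum_(L : {set V} | L \subset X)
    \sum_(Y : {set V} | Y \subset X) F (config X L Y).
Proof.
pose cf (t : {set V} * ({set V} * {set V})) := config t.1 t.2.1 t.2.2.
pose cf' tau := (covered tau, (left_side tau, marked tau)).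
rewrite (reindex_onto cf cf') => [|tau _]; last first.
  apply/ffunP => v; rewrite ffunE !inE /=.
  by case: (tau v) => [[]|].
under [RHS]eq_bigr => X _ do rewrite pair_big /=.
rewrite [RHS]pair_big_dep /=; apply: eq_bigl => -[X [L Y]] /=.
apply/eqP/andP => [[_ <- <-]|[LX YX]].
  by split; apply/subsetP => v; rewrite !inE ffunE; case: ifP.
congr (_, (_, _)); apply/setP => v; rewrite !inE ffunE; case: ifP => // /negbT vX.
  by apply/esym/negbTE; apply: contra vX; apply: subsetP.
by apply/esym/negbTE; apply: contra vX; apply: subsetP.
Qed.

Lemma covered_config X L Y : covered (config X L Y) = X.
Proof. by apply/setP => v; rewrite !inE ffunE; case: ifP. Qed.

Lemma left_config X L Y : L \subset X -> left_side (config X L Y) = L.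
Proof.
move=> LX; apply/setP => v; rewrite !inE ffunE; case: ifP => // /negbT vX.
by apply/esym/negbTE; apply: contra vX; apply: subsetP.
Qed.

Lemma marked_config X L Y : Y \subset X -> marked (config X L Y) = Y.
Proof.
move=> LX; apply/setP => v; rewrite !inE ffunE; case: ifP => // /negbT vX.
by apply/esym/negbTE; apply: contra vX; apply: subsetP.
Qed.

Lemma prod_vertex_config X L Y : L \subset X ->
  \prod_v vertex_weight (config X L Y v) v =
  'X^((k + k) * #|~: X| + kp * #|X|) *
  ((\prod_(v in L) ('X^k * y v + x v)) * \prod_(v in X :\: L) x v).
Proof.
move=> LX; rewrite (bigID [in X]) /= mulrC exprD !exprM -mulrA; congr (_ * _).
  rewrite exprD -prodr_const; apply: eq_big => v; first by rewrite inE.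
  by move=> vX; rewrite ffunE (negPf vX).
rewrite -prodr_const [in RHS](big_setID L) /=.
rewrite (big_setID L) /= (setIidPr LX) mulrACA -!big_split /=; congr (_ * _).
  apply: eq_bigr => v vL; rewrite ffunE (subsetP LX) // vL /=.
  by rewrite addrC.
by apply: eq_bigr => v; rewrite !inE => /andP[vL vX]; rewrite ffunE vX (negPf vL).
Qed.

Lemma prod_edge_config X L Y : L \subset X -> Y \subset X ->
  \prod_(A in edges e) edge_weight (config X L Y) A =
  'X^(k * #|edges_in e X|) * ((unsplit e L X)%:R *
     \prod_(A in edges_in e X) (if A \subset Y then 'X^k * 'X^k + 1 else 1)).
Proof.
move=> LX YX; rewrite /edge_weight covered_config left_config // marked_config //.
rewrite -big_mkcondr /=.
rewrite (eq_bigl [in edges_in e X]) => [|A]; last by rewrite !inE.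
have [us|] := boolP (unsplit e L X).
  rewrite mul1r exprM -prodr_const -big_split /=; apply: eq_bigr => A AE.
  by rewrite (forall_inP us).
rewrite negb_forall => /existsP[A]; rewrite negb_imply => /andP[AE /negPf splA].
by rewrite (bigD1 A) //= splA !mul0r mulr0.
Qed.

Lemma partition_functionE : partition_function =
  \sum_(X : {set V}) \sum_(N : {set V} | (N \subset X) && hits e N X)
    \sum_(M : {set {set V}} | (M \subset edges_in e X) && (cover M == X))
      'X^((k + k) * #|~: X| + kp * #|X| + k * #|edges_in e X| + k * #|N|
          + (k + k) * #|M|) * mono x y X N.
Proof.
rewrite /partition_function sum_config; apply: eq_bigr => X _.
pose E := 'X^((k + k) * #|~: X| + kp * #|X|) * 'X^(k * #|edges_in e X|) : {poly bool}.
(* Once the covered set is fixed, sides and marks are independent and the sum splits into a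
   product. *)
transitivity (E * ((\sum_(L : {set V} | (L \subset X) && unsplit e L X)
    (\prod_(v in L) ('X^k * y v + x v)) * \prod_(v in X :\: L) x v) *
  (\sum_(Y : {set V} | Y \subset X) \prod_(A in edges_in e X)
     (if A \subset Y then 'X^k * 'X^k + 1 else 1)))).
  rewrite mulr_suml mulr_sumr [RHS]big_mkcondr; apply: eq_bigr => L LX.
  transitivity (\sum_(Y : {set V} | Y \subset X) if unsplit e L X then
     E * ((\prod_(v in L) ('X^k * y v + x v)) * \prod_(v in X :\: L) x v *
       \prod_(A in edges_in e X) (if A \subset Y then 'X^k * 'X^k + 1 else 1)) else 0).
    apply: eq_bigr => Y YX; rewrite prod_vertex_config // prod_edge_config //.
    rewrite mulrACA -/E; case: (unsplit _ _ _); rewrite ?mul1r //.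
    by rewrite mul0r !mulr0.
  case: (unsplit _ _ _); last by rewrite big1.
  by rewrite -mulr_sumr -mulr_sumr.
rewrite (sum_sides e polyb_char2) (sum_matchings e polyb_char2).
rewrite mulr_suml mulr_sumr; apply: eq_bigr => N _.
rewrite mulr_sumr mulr_sumr; apply: eq_bigr => M _.
rewrite [_ * mono _ _ _ _ * _]mulrAC mulrA /E -!exprD -!exprM -!exprD.
by rewrite !addnA.
Qed.

(* The terms with [D = 0] and [|X| = j]. *)
Definition root_part (j : nat) : {poly bool} :=
  \sum_(X : {set V} | #|X| == j)
  \sum_(N : {set V} | [&& N \subset X, hits e N X & #|X| == #|N| + #|edges_in e X|]%N)
  \sum_(M : {set {set V}} | perfect e M X) mono x y X N.

(* The exponent of a term is [2 k |V| + k D + kp |X|]. *)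
Lemma coef_partition_function j i : (i < kp)%N -> (j * kp + kp <= k)%N ->
  (forall X N, N \subset X -> (size (mono x y X N) <= kp)%N) ->
  partition_function`_((k + k) * #|V| + j * kp + i) = (root_part j)`_i.
Proof.
move=> ltikp lejk size_mono; rewrite partition_functionE /root_part.
rewrite !coef_sum [RHS]big_mkcond; apply: eq_bigr => X _; rewrite coef_sum.
transitivity (\sum_(N : {set V} | (N \subset X) && hits e N X)
  \sum_(M : {set {set V}} | (M \subset edges_in e X) && (cover M == X))
  if [&& #|X| == j, #|X| == #|N| + #|edges_in e X| & perfect e M X]%N
  then (mono x y X N)`_i else 0); last first.
  case: eqP => [_|_]; last by rewrite big1 // => N _; rewrite big1.
  rewrite coef_sum [RHS](eq_bigl (fun N => ((N \subset X) && hits e N X) &&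
    (#|X| == #|N| + #|edges_in e X|)%N)) => [|N]; last by rewrite /= andbA.
  rewrite [RHS]big_mkcondr; apply: eq_bigr => N _.
  case: ifP => _; last by rewrite big1.
  rewrite coef_sum -big_mkcondr; apply: eq_bigl => M /=.
  rewrite /perfect; case: (_ \subset _); case: (_ == _); by rewrite ?andbT ?andbF.
apply: eq_bigr => N /andP[NX hitN]; rewrite coef_sum; apply: eq_bigr => M /andP[ME /eqP cM].
have [leM eqM] := card_cover_edges e_irr ME cM.
have [leN _] := hits_card e_sym e_irr NX hitN.
rewrite coefXnM -eqM.
have cC : (#|~: X| + #|X| = #|V|)%N by rewrite addnC cardsC.
have nX := size_mono X N NX.
move: leM leN nX; rewrite -cC; move: #|~: X| #|X| #|N| #|edges_in e X| #|M| => c a b f m.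
move: (mono x y X N) => p; clear - ltikp lejk; move=> leM leN szp.
have lekp : (j * kp + i < k)%N by lia.
(* If a summand of D is positive, the exponent is larger by at least [k], beyond the position read,
   since [j * kp + i < k]. The case of the second summand is alike. *)
have [eaM|neM] := eqVneq a (2 * m)%N; last first.
  rewrite [RHS]ifF; last by case: (a == j); case: (a == _).
  rewrite ifT //.
  have : (k * (a + 1) <= k * (2 * m))%N by rewrite leq_mul2l; apply/orP; right; lia.
  have : (k * a <= k * (b + f))%N by rewrite leq_mul2l leN orbT.
  move: lekp; clear; lia.
have [eaN|neN] := eqVneq a (b + f)%N; last first.
  rewrite [RHS]ifF; last by case: (a == j).
  rewrite ifT //.
  have : (k * (a + 1) <= k * (b + f))%N by rewrite leq_mul2l; apply/orP; right; lia.
  have : (k * a <= k * (2 * m))%N by rewrite leq_mul2l leM orbT.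
  move: lekp; clear; lia.
have E : ((k + k) * c + kp * a + k * f + k * b + (k + k) * m =
  (k + k) * (c + a) + a * kp)%N.
  have : (k * a = k * (b + f))%N by rewrite -eaN.
  have : (k * a = k * (2 * m))%N by rewrite -eaM.
  clear; lia.
(* With D = 0 the monomial starts at offset [a * kp] and has length at most [kp], so it touches
   window [a] only. *)
rewrite E; have [eaj|nej] := eqVneq a j.
  by rewrite eaj /= ifF; [congr (_`_ _); lia | lia].
rewrite /=; case: ifP => // /negbT; rewrite -leqNgt => le.
apply: nth_default; apply: leq_trans szp _.
have : (a * kp + kp <= j * kp)%N.
  rewrite -mulSnr leq_mul2r; apply/orP; right.
  rewrite ltn_neqAle nej /= leqNgt; apply/negP => ltja.
  have : (j * kp + kp <= a * kp)%N by rewrite -mulSnr leq_mul2r ltja orbT.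
  by lia.
by lia.
Qed.

End PartitionFunction.

(** * Soundness, completeness and degrees of the part with D = 0 *)

Section RootPart.

Variables (V : finType) (e : rel V).
Hypotheses (e_sym : symmetric e) (e_irr : irreflexive e).
Implicit Types (x y : V -> {poly bool}) (X N : {set V}) (M : {set {set V}}).

Lemma size_mono r x y X N : (0 < r)%N ->
  (forall v, (size (x v) <= r)%N) -> (forall v, (size (y v) <= r)%N) ->
  N \subset X -> (size (mono x y X N) <= (#|V| + 1) * r)%N.
Proof.
move=> r0 szx szy NX.
have size_prod (A : {set V}) (f : V -> {poly bool}) : (forall v, (size (f v) <= r)%N) ->
    (size (\prod_(v in A) f v)%R <= #|A| * r + 1)%N.
  move=> szf; apply: leq_trans (size_prod_leq _ _) _.
  apply: leq_trans (leq_subr _ _) _; rewrite addn1 ltnS -sum_nat_const.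
  exact: leq_sum.
apply: leq_trans (size_polyMleq _ _) _.
have := size_prod N y szy; have := size_prod (X :\: N) x szx.
have : (#|N| + #|X :\: N| <= #|V|)%N.
  by rewrite -{1}(setIidPr NX) cardsID max_card.
move: #|N| #|X :\: N| #|V| => a b c; clear - r0; move=> leV.
have : ((a + b) * r <= c * r)%N by rewrite leq_mul2r leV orbT.
move: (size _) (size _) => s t; lia.
Qed.

(** A nonzero sum has a nonzero term, whose index [M] is the matching. As [x] and [y] are arbitrary,
    no choice of random bits yields a false positive. *)
Lemma root_part_sound x y j : root_part e x y j != 0 ->
  exists M, acyclic_matching e M /\ j = (2 * #|M|)%N.
Proof.
have sum_neq0 (T : finType) (P : pred T) (F : T -> {poly bool}) :
    \sum_(i | P i) F i != 0 -> exists2 i, P i & F i != 0.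
  move=> nz; have [/existsP[i /andP[Pi Fi]]|] := boolP [exists i, P i && (F i != 0)].
    by exists i.
  rewrite negb_exists => /forallP z; case/eqP: nz; apply: big1 => i Pi.
  by have := z i; rewrite Pi negbK => /eqP.
case/sum_neq0 => X /eqP cX /sum_neq0[N /and3P[NX hitN /eqP eqN]] /sum_neq0[M pM _].
have /and3P[ME tM /eqP cM] := pM.
exists M; split; last first.
  by have [_] := card_cover_edges e_irr ME cM; rewrite pM => /eqP <-.
split; last by rewrite cM; have [_] := hits_card e_sym e_irr NX hitN; apply.
split=> //; apply: subset_trans ME _; apply/subsetP => A.
by rewrite inE => /andP[].
Qed.

(** Put x to 1 exactly on X minus N and y to 1 exactly on N. Among the terms of this degree, only
    the monomial of (X, N) survives, and its coefficient is 1 as the perfect matching is unique. *)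
Lemma root_part_complete M : acyclic_matching e M ->
  exists A B : {set V}, root_part e (fun v => (v \in A)%:R) (fun v => (v \in B)%:R)
    (2 * #|M|) = 1.
Proof.
case=> [[Me tM] F]; set X := cover M in F.
have ME : M \subset edges_in e X.
  apply/subsetP => A AM; rewrite inE (subsetP Me) //.
  exact: (bigcup_sup A).
have pM : perfect e M X by rewrite /perfect ME tM eqxx.
have cX : #|X| = (2 * #|M|)%N.
  by have [_] := card_cover_edges e_irr ME erefl; rewrite pM => /eqP.
have [N [NX hitN cN]] := forest_roots e_sym e_irr F.
have monoE X' N' : N' \subset X' -> #|X'| = #|X| ->
    mono (fun v => (v \in X :\: N)%:R) (fun v => (v \in N)%:R) X' N'
      = ((X' == X) && (N' == N))%:R :> {poly bool}.
  have prodE (C D : {set V}) : \prod_(v in C) (v \in D)%:R = (C \subset D)%:R :> {poly bool}.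
    have [CD|/subsetPn[v vC vD]] := boolP (C \subset D).
      by rewrite big1 // => v vC; rewrite (subsetP CD).
    by rewrite (bigD1 v) //= (negPf vD) mul0r.
  move=> N'X' cX'; rewrite /mono !prodE -natrM mulnb; congr (_%:R); congr nat_of_bool.
  apply/andP/andP => [[N'N DD]|[/eqP-> /eqP->]] //.
  have eX : X' = X.
    apply/eqP; rewrite eqEcard cX' leqnn andbT; apply/subsetP => v vX'.
    have [vN'|vN'] := boolP (v \in N'); first by rewrite (subsetP NX) // (subsetP N'N).
    have /(subsetP DD) : v \in X' :\: N' by rewrite inE vN'.
    by rewrite inE => /andP[].
  split; first by apply/eqP.
  rewrite eqEsubset N'N; apply/subsetP => v vN; apply: contraT => vN'.
  have /(subsetP DD) : v \in X' :\: N' by rewrite inE vN' eX (subsetP NX).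
  by rewrite inE vN.
exists (X :\: N), N; rewrite /root_part (bigD1 X) /=; last by rewrite cX.
rewrite [X in _ + X]big1 ?addr0 => [|X' /andP[/eqP cX' neX]]; last first.
  rewrite big1 // => N' /and3P[N'X' _ _]; rewrite big1 // => M' _.
  by rewrite monoE ?cX ?(negPf neX).
rewrite (bigD1 N) /=; last by rewrite NX hitN cN eqxx.
rewrite [X in _ + X]big1 ?addr0 => [|N' /andP[/and3P[N'X' _ _] neN]]; last first.
  by rewrite big1 // => M' _; rewrite monoE // (negPf neN) andbF.
rewrite (big_pred1 M) => [|M' /=]; first by rewrite monoE // !eqxx.
apply/idP/eqP => [pM'|->] //.
exact: forest_perfect_unique F pM' pM.
Qed.

(** Degree at most one in one variable, stated by interpolation at 0 and 1 so that no multivariate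
    polynomials are needed. *)
Definition affine (h : {poly bool} -> {poly bool}) : Prop :=
  forall a, h a = h 0 + a * (h 1 - h 0).

Lemma affine_sum (T : finType) (P : pred T) (h : T -> {poly bool} -> {poly bool}) :
  (forall i, affine (h i)) -> affine (fun a => \sum_(i | P i) h i a).
Proof.
move=> H a; rewrite -sumrB mulr_sumr -big_split /=; apply: eq_bigr => i _.
exact: H.
Qed.

Lemma affine_prod (A : {set V}) (f : V -> {poly bool}) v0 :
  affine (fun a => \prod_(v in A) (if v == v0 then a else f v)).
Proof.
move=> a; have [vA|vA] := boolP (v0 \in A).
  rewrite !(bigD1 v0 vA) /= !eqxx mul0r add0r subr0 mul1r; congr (_ * _).
  by apply: eq_bigr => v /andP[_ /negPf->].
suff E b : \prod_(v in A) (if v == v0 then b else f v) = \prod_(v in A) f v.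
  by rewrite !E subrr mulr0 addr0.
by apply: eq_bigr => v vA'; rewrite ifF //; apply: contraNF vA => /eqP <-.
Qed.

Lemma root_part_affine_x x y j v0 :
  affine (fun a => root_part e (fun v => if v == v0 then a else x v) y j).
Proof.
apply: affine_sum => X; apply: affine_sum => N; apply: affine_sum => M a.
by rewrite /mono [in LHS](affine_prod _ _ _ a) mulrDr -mulrBr [in RHS]mulrCA.
Qed.

Lemma root_part_affine_y x y j v0 :
  affine (fun a => root_part e x (fun v => if v == v0 then a else y v) j).
Proof.
apply: affine_sum => X; apply: affine_sum => N; apply: affine_sum => M a.
by rewrite /mono [in LHS](affine_prod _ _ _ a) mulrDl -mulrBl mulrA.
Qed.

Lemma eq_root_part x y x' y' j : x =1 x' -> y =1 y' ->
  root_part e x y j = root_part e x' y' j.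
Proof.
move=> ex ey; apply: eq_bigr => X _; apply: eq_bigr => N _; apply: eq_bigr => M _.
by congr (_ * _); apply: eq_bigr => v _; [exact: ey | exact: ex].
Qed.

Lemma root_part_large x y j : (#|V| < j)%N -> root_part e x y j = 0.
Proof.
move=> ltj; rewrite /root_part big_pred0 // => X; apply/negbTE.
by rewrite neq_ltn (leq_ltn_trans _ ltj) // max_card.
Qed.

End RootPart.

(** * Variable elimination *)

Section Elimination.

Variables (V T : finType) (R : comNzRingType).
Notation assignment := {ffun V -> T}.
Implicit Types (l : seq V) (F G : assignment -> R) (tau s : assignment) (D : pred V).

Definition upd s v a : assignment := [ffun w => if w == v then a else s w].

Fixpoint sum_over l F s : R :=
  if l is v :: l' then \sum_(a : T) sum_over l' F (upd s v a) else F s.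

Definition depends D F : Prop := forall tau s, {in D, tau =1 s} -> F tau = F s.

Lemma sum_over_cat l1 l2 F s :
  sum_over (l1 ++ l2) F s = sum_over l1 (sum_over l2 F) s.
Proof. by elim: l1 s => //= v l1 IH s; apply: eq_bigr => a _; apply: IH. Qed.

Lemma eq_sum_over l F G s : F =1 G -> sum_over l F s = sum_over l G s.
Proof. by move=> E; elim: l s => //= v l IH s; apply: eq_bigr. Qed.

Lemma sum_over_depends l D F : depends D F ->
  depends [pred v in D | v \notin l] (sum_over l F).
Proof.
move=> depF; elim: l => [|v l IH] tau s E /=.
  by apply: depF => w wD; apply: E; rewrite inE /= wD.
apply: eq_bigr => a _; apply: IH => w; rewrite inE /= => /andP[wD wl].
rewrite !ffunE; case: eqP => // /eqP ne; apply: E.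
by rewrite inE /= wD in_cons negb_or ne.
Qed.

Lemma sum_overMl l D F G s : depends D F -> {in l, forall v, ~~ D v} ->
  sum_over l (fun tau => F tau * G tau) s = F s * sum_over l G s.
Proof.
move=> depF; elim: l s => //= v l IH s nD; rewrite mulr_sumr.
apply: eq_bigr => a _; rewrite IH => [|w wl]; last by apply: nD; rewrite in_cons wl orbT.
congr (_ * _); apply: depF => w wD; rewrite ffunE; case: eqP => // ew.
by have := nD v (mem_head _ _); rewrite -ew => /negP[]; exact: wD.
Qed.

(** The distributive law behind the pointwise product at a join: neither factor sees the variables
    summed on the other side. *)
Lemma sum_over_join l1 l2 D1 D2 F1 F2 s : depends D1 F1 -> depends D2 F2 ->
  {in l2, forall v, ~~ D1 v} -> {in l1, forall v, ~~ D2 v} ->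
  sum_over (l1 ++ l2) (fun tau => F1 tau * F2 tau) s = sum_over l1 F1 s * sum_over l2 F2 s.
Proof.
move=> dep1 dep2 n1 n2; rewrite sum_over_cat.
have -> : sum_over l1 (sum_over l2 (fun tau => F1 tau * F2 tau)) s
    = sum_over l1 (fun tau => sum_over l2 F2 tau * F1 tau) s.
  by apply: eq_sum_over => tau; rewrite (sum_overMl _ _ dep1) // mulrC.
rewrite mulrC (sum_overMl _ _ (sum_over_depends (l := l2) dep2)) // => v vl.
by rewrite inE /= negb_and; apply/orP; left; apply: n2.
Qed.

Lemma sum_overE l F s : uniq l ->
  sum_over l F s =
  \sum_(tau : assignment | [forall v, (v \notin l) ==> (tau v == s v)]) F tau.
Proof.
elim: l s => [|v l IH] s /=.
  move=> _; rewrite (big_pred1 s) // => tau /=.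
  apply/forallP/eqP => [E|-> w]; last exact: eqxx.
  by apply/ffunP => w; apply/eqP; have := E w.
case/andP=> vl ul.
rewrite (partition_big (fun tau : assignment => tau v) xpredT) //=.
apply: eq_bigr => a _; rewrite IH //; apply: eq_bigl => tau.
apply/forallP/andP => [E|[/forallP E /eqP ea] w].
  split; last by have := E v; rewrite vl ffunE eqxx.
  apply/forallP => w; apply/implyP; rewrite in_cons negb_or => /andP[ne wl].
  by have := E w; rewrite wl ffunE (negPf ne).
apply/implyP => wl; rewrite ffunE; have [->|ne] := eqVneq w v; first by rewrite ea.
by have := E w; rewrite in_cons negb_or ne wl.
Qed.

End Elimination.

Section Decomposition.

Variables (V : finType) (e : rel V).
Hypotheses (e_sym : symmetric e) (e_irr : irreflexive e).
Variables (kp k : nat) (x y : V -> {poly bool}).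
Notation vw := (vertex_weight kp k x y).
Notation pw := (pair_weight k).

Fixpoint node_weight (t : ntd V) (tau : {ffun V -> vstate}) : {poly bool} :=
  match t with
  | Leaf => 1
  | Introduce _ u => node_weight u tau
  | Forget v u =>
      (vw (tau v) v * \prod_(w in bag t | e v w) pw (tau v) (tau w)) * node_weight u tau
  | Join u1 u2 => node_weight u1 tau * node_weight u2 tau
  end.

Lemma node_weightE t tau : node_weight t tau =
  (\prod_(v <- forgotten t) vw (tau v) v) *
  \prod_(A <- counted e t) edge_weight k tau A.
Proof.
elim: t => [|w u IH|w u IH|u1 IH1 u2 IH2] //=.
- by rewrite !big_nil mulr1.
- rewrite big_cons big_cat IH big_map big_enum /=.
  rewrite -!mulrA; congr (_ * _); rewrite mulrCA; congr (_ * (_ * _)).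
  by apply: eq_big => [z|z _]; rewrite ?edge_weight2.
- by rewrite !big_cat /= IH1 IH2 mulrACA.
Qed.

Lemma node_weight_depends t : nice t ->
  depends [pred v | (v \in bag t) || (v \in forgotten t)] (node_weight t).
Proof.
elim: t => [|w u IH|w u IH|u1 IH1 u2 IH2] //=.
- case/andP=> _ nu tau s E; apply: (IH nu) => v; rewrite inE => vu.
  by apply: E; rewrite !inE; case/orP: vu => ->; rewrite ?orbT.
- case/andP=> wu nu tau s E.
  have Ew : tau w = s w by apply: E; rewrite !inE eqxx orbT.
  rewrite Ew; congr (_ * _ * _).
    by apply: eq_bigr => v /andP[vb _]; rewrite E // inE /= vb.
  apply: (IH nu) => v; rewrite inE => vu; apply: E; rewrite !inE.
  by case: eqP; rewrite ?orbT.
- case/and3P=> /eqP eb n1 n2 tau s E.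
  rewrite (IH1 n1 tau s) ?(IH2 n2 tau s) // => v; rewrite inE => vu; apply: E;
    rewrite !inE mem_cat; case/orP: vu => H; rewrite ?H ?orbT //.
  by rewrite eb H.
Qed.

Lemma elimination_root t s : nice_tree_decomposition e t ->
  sum_over (forgotten t) (node_weight t) s = partition_function e kp k x y.
Proof.
move=> dt; have [nt _ _] := dt.
have [sep cov covE] := decomposition_forgotten e_sym e_irr dt.
have uf := uniq_forgotten nt sep.
rewrite sum_overE // /partition_function; apply: eq_big => tau.
  by apply/forallP => v; rewrite cov.
move=> _; rewrite node_weightE; congr (_ * _).
  by rewrite big_uniq //=; apply: eq_bigl => v; rewrite cov.
by rewrite big_uniq ?uniq_counted //=; apply: eq_bigl => A; apply: covE.
Qed.

End Decomposition.

(** * The bit-list program computes the partition function *)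

Lemma Poly_cons a p : Poly (a :: p) = Poly p * 'X + a%:P :> {poly bool}.
Proof. exact: cons_poly_def. Qed.

#[local] Arguments Poly : simpl never.

Lemma Poly_true : Poly [:: true] = 1 :> {poly bool}.
Proof. by rewrite Poly_cons mul0r add0r. Qed.

Lemma Poly_xorl p q : Poly (xorl p q) = Poly p + Poly q :> {poly bool}.
Proof.
apply/polyP => i; rewrite coefD !coef_Poly.
by elim: p q i => [|a p IH] [|b q] [|i] //=; rewrite ?nth_nil ?addr0 ?add0r.
Qed.

Lemma Poly_shl j p : Poly (shl j p) = 'X^j * Poly p :> {poly bool}.
Proof.
elim: j => [|j IH]; first by rewrite mul1r.
by rewrite /shl /= Poly_cons addr0 IH exprS mulrC mulrA.
Qed.

Lemma Poly_mull p q : Poly (mull p q) = Poly p * Poly q :> {poly bool}.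
Proof.
elim: p => [|a p IH] /=; first by rewrite mul0r.
rewrite Poly_cons mulrDl mulrAC -IH.
case: a; rewrite ?Poly_xorl Poly_cons addr0 ?mul1r ?mul0r ?addr0 //.
by rewrite addrC.
Qed.

Lemma Poly_sum_bits l f : Poly (sum_bits l f) = \sum_(a <- l) Poly (f a) :> {poly bool}.
Proof.
by elim: l => [|a l IH] /=; rewrite ?big_nil // Poly_xorl big_cons IH.
Qed.

Lemma sum_vstate (F : vstate -> {poly bool}) :
  \sum_a F a = \sum_(a <- all_st) F a.
Proof.
rewrite -[LHS]big_enum; apply: perm_big; apply: uniq_perm => //.
  exact: enum_uniq.
by move=> [[[] []]|]; rewrite mem_enum.
Qed.

Lemma Poly_pair_bits k s s' : Poly (pair_bits k s s') = pair_weight k s s'.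
Proof.
case: s s' => [[l a]|] [[l' b]|]; rewrite /pair_bits ?Poly_true //.
rewrite /pair_weight; case: (l (+) l') => //.
rewrite Poly_shl; case: (a && b); rewrite ?Poly_xorl ?Poly_shl Poly_true //.
by rewrite mulr1.
Qed.

Lemma Poly_edges_bits k st row s : size row = size s ->
  Poly (edges_bits k st row s) =
  \prod_(i < size s | nth false row i) pair_weight k st (nth None s i).
Proof.
elim: row s => [|a row IH] [|u s] //=; first by rewrite big_ord0 Poly_true.
case=> /IH E; rewrite big_mkcond big_ord_recl /=.
rewrite -[X in _ * X]big_mkcond /= -E.
by case: a; rewrite ?Poly_mull ?Poly_pair_bits ?mul1r.
Qed.

Lemma nth_restr m s i :
  nth None (restrict m s) i = if nth false m i then nth None s i else None.
Proof.
elim: m s i => [|b m IH] [|a s] [|i] //=; rewrite ?nth_nil //.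
all: by case: ifP.
Qed.

Lemma size_restr m s : size m = size s -> size (restrict m s) = size s.
Proof. by elim: m s => [|b m IH] [|a s] //= [/IH->]. Qed.

Section ListProgram.

Variables (n kp k : nat) (e : rel 'I_n) (rnd : seq (seq bool * seq bool)).
Hypotheses (e_sym : symmetric e) (e_irr : irreflexive e).

Definition poly_x (v : 'I_n) : {poly bool} := Poly (nth ([::], [::]) rnd v).1.
Definition poly_y (v : 'I_n) : {poly bool} := Poly (nth ([::], [::]) rnd v).2.

Lemma Poly_vertex_bits a (v : 'I_n) (xy := nth ([::], [::]) rnd v) :
  Poly (vertex_bits kp k xy.1 xy.2 a) = vertex_weight kp k poly_x poly_y a v.
Proof.
case: a => [[[] b]|]; rewrite /vertex_bits /vertex_weight !Poly_shl ?Poly_xorl ?Poly_shl //.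
by rewrite Poly_true mulr1.
Qed.

Definition state_of (s : seq vstate) : {ffun 'I_n -> vstate} :=
  [ffun i : 'I_n => nth None s i].

Lemma state_of_set s (v : 'I_n) a : state_of (set_nth None s v a) = upd (state_of s) v a.
Proof. by apply/ffunP => w; rewrite !ffunE nth_set_nth. Qed.

Lemma nth_bag_mask t (i : 'I_n) : nth false (bag_mask t) i = (i \in bag t).
Proof. by rewrite (nth_map i) ?size_enum_ord // nth_ord_enum. Qed.

Lemma nth_rows_of (v w : 'I_n) : nth false (nth [::] (rows_of e) v) w = e v w.
Proof.
by rewrite (nth_map v) ?size_enum_ord // nth_ord_enum (nth_map w) ?size_enum_ord //
  nth_ord_enum.
Qed.

Lemma size_nth_rows_of (v : 'I_n) : size (nth [::] (rows_of e) v) = n.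
Proof. by rewrite (nth_map v) ?size_enum_ord // size_map size_enum_ord. Qed.

(** A table entry is the node weight summed over all states of the forgotten vertices. What remains
    depends on the bag alone, which justifies restricting the state list. *)
Lemma Poly_dp_bits t s : nice t -> separated t -> size s = n ->
  Poly (dp_bits kp k (rows_of e) rnd t s) =
  sum_over (forgotten t) (node_weight e kp k poly_x poly_y t) (state_of s).
Proof.
have restr_bag t' s' (tau : {ffun 'I_n -> vstate}) : nice t' -> separated t' ->
   {in bag t', state_of s' =1 tau} ->
   sum_over (forgotten t') (node_weight e kp k poly_x poly_y t') (state_of s') =
   sum_over (forgotten t') (node_weight e kp k poly_x poly_y t') tau.
  move=> nt st E; apply: (sum_over_depends (node_weight_depends e kp k poly_x poly_y nt)).
  by move=> v /andP[/orP[vb _|/= ->//]]; apply: E.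
have restrE t' s' : {in bag t', state_of (restrict (bag_mask t') s') =1 state_of s'}.
  by move=> v vb; rewrite !ffunE nth_restr nth_bag_mask vb.
elim: t s => [|v u IH|v u IH|u1 IH1 u2 IH2] s nt st szs.
- by rewrite [dp_bits _ _ _ _ _ _]/= Poly_true.
- by case/andP: nt => _ nu; case/andP: st => _ su; exact: IH.
- rewrite -(restr_bag _ (restrict (bag_mask (Forget v u)) s)) //.
  case/andP: (nt) => vu nu.
  set s' := restrict _ s.
  have szs' : size s' = n by rewrite size_restr ?size_bag_mask ?szs.
  rewrite [dp_bits _ _ _ _ _ _]/= -/s' Poly_sum_bits [forgotten _]/= [sum_over _ _ _]/= sum_vstate.
  apply: eq_bigr => a _.
  rewrite !Poly_mull IH ?size_set_nth ?szs' //; last by apply/maxn_idPr.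
  rewrite state_of_set.
  have notb w : w \in forgotten u -> w \notin bag u by apply: forgotten_notin_bag.
  (* The new factors involve only vertices of the child's bag; none of these has been summed over,
     so the factors move out of the sum. *)
  rewrite (sum_overMl (D := [pred w | w \in bag u])); last 2 first.
  - move=> tau tau' E; have Ev : tau v = tau' v by apply: E.
    rewrite Ev; congr (_ * _); apply: eq_bigr => w /andP[wb _].
    by rewrite E //; move: wb; rewrite !inE => /andP[].
  - by move=> w; apply: notb.
  rewrite mulrA ffunE eqxx; congr (_ * _ * _); first exact: Poly_vertex_bits.
  rewrite Poly_edges_bits ?size_nth_rows_of ?szs' // big_mkcond [RHS]big_mkcond /=.
  apply: eq_bigr => w _; rewrite nth_rows_of.
  have nb w' : w' \notin bag (Forget v u) -> nth None s' w' = None.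
    by move=> /negPf nw; rewrite nth_restr nth_bag_mask nw.
  have [wb|wb] := boolP (w \in bag u :\ v); last first.
    by case: ifP => // _; rewrite nb //; case: a => [[]|].
  by case: (e v w) => //; rewrite !ffunE; case/setD1P: wb => /negPf->.
case/and3P: (nt) => /eqP eb n1 n2; case/and3P: (st) => dis s1 s2.
have szr : size (restrict (bag_mask (Join u1 u2)) s) = n by rewrite size_restr ?size_bag_mask ?szs.
rewrite [dp_bits _ _ _ _ _ _]/= Poly_mull IH1 // IH2 //.
rewrite (restr_bag _ _ (state_of s)) ?(restr_bag u2 _ (state_of s)) //; last first.
- by move=> w wb; apply: restrE.
- by move=> w wb; apply: restrE; rewrite /= eb.
rewrite [RHS](sum_over_join (D1 := [pred v | (v \in bag u1) || (v \in forgotten u1)])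
  (D2 := [pred v | (v \in bag u2) || (v \in forgotten u2)])) //.
- exact: node_weight_depends.
- exact: node_weight_depends.
- move=> w w2; rewrite /= negb_or eb (forgotten_notin_bag n2 s2) //=.
  exact: (hasPn dis).
move=> w w1; rewrite /= negb_or -eb (forgotten_notin_bag n1 s1) //=.
by apply: contraL w1 => w2; exact: (hasPn dis).
Qed.

End ListProgram.

(** * Probability *)

Fixpoint blocks (m r : nat) (w : seq bool) : seq (seq bool) :=
  if m is m'.+1 then take r w :: blocks m' r (drop r w) else [::].

Lemma size_blocks m r w : size (blocks m r w) = m.
Proof. by elim: m w => //= m IH w; rewrite IH. Qed.

(** Fixes the numbering of the variables: number [2 * v] is x_v and number [2 * v + 1] is y_v. *)
Lemma nth_random_pairs c r w i : nth ([::], [::]) (random_pairs c r w) i =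
  (nth [::] (blocks c.*2 r w) i.*2, nth [::] (blocks c.*2 r w) i.*2.+1).
Proof.
by elim: c w i => [|c IH] w [|i]; rewrite ?nth_nil //= IH.
Qed.

Lemma card_tuple_cat r B (Q : pred (seq bool)) :
  #|[set w : (r + B).-tuple bool | Q w]| =
  (\sum_(b : B.-tuple bool) #|[set a : r.-tuple bool | Q (a ++ b)]|)%N.
Proof.
under [RHS]eq_bigr => b _ do rewrite -sum1dep_card.
rewrite -sum1dep_card.
pose f (p : B.-tuple bool * r.-tuple bool) := cat_tuple p.2 p.1.
have f_bij : bijective f.
  exists (fun w : (r + B).-tuple bool =>
    (tcast (addKn r B) (drop_tuple r w),
     tcast (minn_idPl (leq_addr B r)) (take_tuple r w))).
    move=> [b a]; congr (_, _); apply: val_inj; rewrite /= val_tcast /=.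
      by rewrite drop_size_cat ?size_tuple.
    by rewrite take_size_cat ?size_tuple.
  move=> w; apply: val_inj; rewrite /= !val_tcast /=; exact: cat_take_drop.
rewrite (reindex f) /=; last by apply: onW_bij.
by rewrite pair_big_dep.
Qed.

(** The common length makes trailing zeros harmless, so a block of [r] fair bits is uniform over
    [2 ^ r] distinct values. *)
Lemma Poly_inj r (a b : r.-tuple bool) : Poly a = Poly b :> {poly bool} -> a = b.
Proof.
move=> E; apply: val_inj; apply: (@eq_from_nth _ false); rewrite !size_tuple //.
by move=> i _; have := congr1 (fun p : {poly bool} => p`_i) E; rewrite !coef_Poly.
Qed.

Definition multiaffine m (P : seq {poly bool} -> {poly bool}) : Prop :=
  forall z i, size z = m -> (i < m)%N -> affine (fun a => P (set_nth 0 z i a)).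

(* Schwartz-Zippel: once all the other variables are such that the restriction
   to the first coordinate of the witness does not vanish, at most one value of
   the first variable is a root. *)
Lemma multiaffine_roots r m P (bs : seq bool) B : multiaffine m P -> size bs = m ->
  P [seq b%:R | b : bool <- bs] != 0 -> (m * r <= B)%N ->
  (#|[set w : B.-tuple bool | P (map (fun s => Poly s) (blocks m r w)) == 0%R]| * 2 ^ r
     <= m * 2 ^ B)%N.
Proof.
elim: m P bs B => [|m IH] P bs B affP szb nzP leB.
  rewrite (_ : [set w | _] = set0) ?cards0 //; apply/setP => w; rewrite !inE.
  by case: bs szb nzP => // _ /negPf.
case: bs szb nzP => [//|b0 bs] [szb] nzP.
have [B' eqB] : exists B', B = (r + B')%N by exists (B - r)%N; rewrite subnKC //; nia.
subst B; pose C zs := P (b0%:R :: zs).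
have affC : multiaffine m C.
  by move=> z i szz ltim; apply: (affP (b0%:R :: z) i.+1); rewrite /= ?szz.
have leB' : (m * r <= B')%N by move: leB; rewrite mulSn leq_add2l.
have {}IH := IH C bs B' affC szb nzP leB'.
set bad := [set w : B'.-tuple bool | _] in IH.
rewrite (@card_tuple_cat r B' (fun w => P (map (fun s => Poly s) (blocks m.+1 r w)) == 0%R)).
have root1 (b : B'.-tuple bool) : b \notin bad ->
   (#|[set a : r.-tuple bool |
        P (map (fun s => Poly s) (blocks m.+1 r (a ++ b))) == 0%R]| <= 1)%N.
  rewrite inE => nzC; apply/card_le1_eqP => a a'.
  rewrite !inE /= !take_size_cat ?drop_size_cat ?size_tuple //.
  set zs := map _ _ in nzC *; have szs : size zs = m by rewrite size_map size_blocks.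
  have aff c : P (c :: zs) = P (0 :: zs) + c * (P (1 :: zs) - P (0 :: zs)).
    by apply: (affP (0 :: zs) 0%N) => //=; rewrite szs.
  rewrite (aff (Poly a)) (aff (Poly a')) => /eqP ra /eqP ra'.
  apply: Poly_inj; apply/eqP; rewrite -subr_eq0; apply: contraNT nzC => ne.
  (* Two distinct roots force the slope [d] to vanish in the domain F_2[X]; the restriction is then
     constantly zero, also at the witness coordinate, against [nzC]. *)
  set d := P (1 :: zs) - P (0 :: zs) in ra ra' aff.
  have d0 : d = 0.
    have ea : Poly a * d = - P (0 :: zs) by apply/eqP; rewrite -addr_eq0 addrC ra.
    have ea' : Poly a' * d = - P (0 :: zs) by apply/eqP; rewrite -addr_eq0 addrC ra'.
    by apply/eqP; rewrite -(mulrI_eq0 _ (mulfI ne)) mulrBl ea ea' subrr.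
  by rewrite /C aff d0 mulr0 addr0; move: ra; rewrite d0 mulr0 addr0 => ->.
(* A bad tail may lose all [2 ^ r] first blocks, any other tail loses at most one. *)
have le_card (b : B'.-tuple bool) :
   (#|[set a : r.-tuple bool |
        P (map (fun s => Poly s) (blocks m.+1 r (a ++ b))) == 0%R]|
     <= 1 + 2 ^ r * (b \in bad))%N.
  case: (boolP (b \in bad)) => [_|nb]; last by rewrite muln0 addn0 root1.
  rewrite muln1 (leq_trans (max_card _)) // card_tuple card_bool; lia.
apply: leq_trans (leq_mul (leq_sum _ (fun b _ => le_card b)) (leqnn _)) _.
rewrite big_split /= sum1_card card_tuple card_bool -big_distrr /=.
have -> : (\sum_(b : B'.-tuple bool) (b \in bad) = #|bad|)%N.
  by rewrite -sum1_card [RHS]big_mkcond.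
rewrite expnD; move: (2 ^ B')%N (2 ^ r)%N #|bad| IH => x y c; clear; nia.
Qed.

Lemma root_part_multiaffine n (e : rel 'I_n) j : multiaffine n.*2 (fun z =>
  root_part e (fun v : 'I_n => z`_(v.*2)) (fun v : 'I_n => z`_(v.*2.+1)) j).
Proof.
move=> z i szz lti.
have affine_ext h h' : h =1 h' -> affine h' -> affine h.
  by move=> E A a; rewrite !E.
have ltv : (i./2 < n)%N by rewrite -divn2 ltn_divLR // muln2.
have ei := odd_double_half i; case: (odd i) ei => /= ei.
  apply: (affine_ext _ _ _ (root_part_affine_y e (fun v : 'I_n => z`_(v.*2))
    (fun v : 'I_n => z`_(v.*2.+1)) j (Ordinal ltv))) => a.
  apply: eq_root_part => v; rewrite nth_set_nth /= -{1}ei.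
    by rewrite ifF //; apply/negP => /eqP; lia.
  by rewrite add1n eqSS (inj_eq double_inj).
apply: (affine_ext _ _ _ (root_part_affine_x e (fun v : 'I_n => z`_(v.*2))
  (fun v : 'I_n => z`_(v.*2.+1)) j (Ordinal ltv))) => a.
apply: eq_root_part => v; rewrite nth_set_nth /= -{1}ei.
  by rewrite add0n (inj_eq double_inj).
by rewrite ifF //; apply/negP => /eqP; lia.
Qed.

Local Close Scope ring_scope.

(** * Reading the answer off the coefficients *)

Lemma drop_block (T : Type) m j (p : seq T) :
  drop (m * (j + j)) (drop j (drop j p)) = drop (m.+1 * (j + j)) p.
Proof. by rewrite !drop_drop; congr (drop _ _); lia. Qed.

Lemma best_max c j p m : m < c ->
  has id (take j (drop (m * (j + j)) p)) -> m < best c j p.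
Proof.
elim: c p m => //= c IH p [|m] ltm H.
  by case: (best c j _) => //; rewrite mul0n drop0 in H; rewrite H.
have := IH (drop j (drop j p)) m ltm; rewrite drop_block => /(_ H).
by case: (best c j _).
Qed.

Lemma best_witness c j p m : best c j p = m.+1 ->
  has id (take j (drop (m * (j + j)) p)).
Proof.
elim: c p m => //= c IH p m; case E: (best c j _) => [|m'].
  by case H: (has _ _) => // -[<-]; rewrite mul0n drop0.
by case=> <-; have := IH _ _ E; rewrite drop_block.
Qed.

Lemma has_window (j d K o : nat) (z : seq bool) :
  reflect (exists2 i, i < j & (d + i < K) && nth false z (o + (d + i)))
    (has id (take j (drop d (take K (drop o z))))).
Proof.
apply: (iffP (has_nthP false)) => [[i lti]|[i lti /andP[ltK nz]]].
  move: lti; rewrite size_take_min leq_min => /andP[lti _].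
  rewrite nth_take // nth_drop => nz; exists i => //.
  have ltK : d + i < K.
    rewrite ltnNge; apply: contraL nz => le.
    by rewrite nth_default // size_take_min geq_min le.
  by rewrite ltK; move: nz; rewrite nth_take // nth_drop.
exists i; last by rewrite nth_take // nth_drop nth_take // nth_drop.
have lez : o + (d + i) < size z.
  by rewrite ltnNge; apply: contraL nz => le; rewrite nth_default.
by rewrite size_take_min size_drop size_take_min size_drop; lia.
Qed.

Lemma eq_partition_function (V : finType) (e : rel V) kp k x y x' y' :
  x =1 x' -> y =1 y' ->
  partition_function e kp k x y = partition_function e kp k x' y'.
Proof.
move=> ex ey; apply: eq_bigr => tau _; congr (_ * _)%R; apply: eq_bigr => v _.
by rewrite /vertex_weight ex ey.
Qed.

Section Answer.

Variables (n : nat) (e : rel 'I_n) (t : ntd 'I_n).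
Hypotheses (e_sym : symmetric e) (e_irr : irreflexive e).
Hypothesis decomposition : nice_tree_decomposition e t.

Definition tape_point (w : seq bool) : seq {poly bool} :=
  map (fun s => Poly s) (blocks n.*2 (rbits n) w).

Definition root_value j (z : seq {poly bool}) : {poly bool} :=
  root_part e (fun v : 'I_n => z`_(v.*2))%R (fun v : 'I_n => z`_(v.*2.+1))%R j.

Lemma Poly_partition_bits w : (Poly (partition_bits e t w) =
  partition_function e (kpow n) (kbig n) (fun v : 'I_n => (tape_point w)`_(v.*2))
    (fun v : 'I_n => (tape_point w)`_(v.*2.+1)))%R.
Proof.
have [nt _ _] := decomposition.
have [sep _ _] := decomposition_forgotten e_sym e_irr decomposition.
rewrite Poly_dp_bits ?size_nseq // elimination_root //.
have point i : i < n.*2 ->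
    (Poly (nth [::] (blocks n.*2 (rbits n) w) i) = (tape_point w)`_i)%R.
  by move=> lti; rewrite (nth_map [::]) ?size_blocks.
apply: eq_partition_function => v; have ltv := ltn_ord v.
  by rewrite /poly_x nth_random_pairs point //; lia.
by rewrite /poly_y nth_random_pairs point //; lia.
Qed.

Lemma size_mono_point w (X N : {set 'I_n}) : N \subset X ->
  size (mono (fun v : 'I_n => (tape_point w)`_(v.*2))%R
    (fun v : 'I_n => (tape_point w)`_(v.*2.+1))%R X N) <= kpow n.
Proof.
have szp i : size (nth 0%R (tape_point w) i) <= rbits n.
  have [lti|gei] := ltnP i n.*2; last by rewrite nth_default ?size_poly0 // size_map size_blocks.
  rewrite (nth_map [::]) ?size_blocks //; apply: leq_trans (size_Poly _) _.
  elim: (n.*2) i w {lti} => [|m IH] [|i] w //=.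
  by rewrite size_take_min geq_minl.
move=> NX; have := @size_mono _ (rbits n) (fun v : 'I_n => (tape_point w)`_(v.*2))%R
 (fun v : 'I_n => (tape_point w)`_(v.*2.+1))%R X N.
by rewrite card_ord; apply=> //; rewrite /rbits addn3.
Qed.

Lemma size_root_value w j : (size (root_value j (tape_point w)) <= kpow n)%N.
Proof.
have szs (T : finType) (Q : pred T) (f : T -> {poly bool}) b :
   (forall i, Q i -> size (f i) <= b) -> size (\sum_(i | Q i) f i)%R <= b.
  move=> H; apply: leq_trans (size_sum _ _ _) _; apply/bigmax_leqP => i; exact: H.
apply: (szs) => X _; apply: (szs) => N /and3P[NX _ _]; apply: (szs) => M _.
exact: size_mono_point.
Qed.

Lemma nth_partition_bits w j i : i < kpow n -> j * kpow n + kpow n <= kbig n ->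
  nth false (partition_bits e t w) (n * (kbig n + kbig n) + (j * kpow n + i)) =
  ((root_value j (tape_point w))`_i)%R.
Proof.
move=> lti lej; rewrite /root_value.
rewrite -(coef_partition_function e_sym e_irr lti lej (@size_mono_point w)).
by rewrite -Poly_partition_bits coef_Poly card_ord mulnC addnA.
Qed.

Lemma block_root_value w m :
  has id (take (kpow n) (drop (m * (kpow n + kpow n))
    (drop (kpow n) (drop (kpow n)
      (take (kbig n) (drop (n * (kbig n + kbig n)) (partition_bits e t w)))))))
  = (root_value (2 * m.+1) (tape_point w) != 0)%R.
Proof.
rewrite drop_block (_ : m.+1 * (kpow n + kpow n) = 2 * m.+1 * kpow n); last by lia.
set j := 2 * m.+1.
(* For [j > n] the window starts at or beyond the cut at [kbig], and no set of [j] vertices exists: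
   both sides are false. *)
have [lejn|ltnj] := leqP j n; last first.
  rewrite /root_value root_part_large ?card_ord // eqxx; apply/negP => /has_window[i _].
  case/andP=> ltK _; move: ltK; rewrite ltnNge => /negP; apply.
  rewrite /kbig addn1 (leq_trans _ (leq_addr _ _)) // leq_mul2r ltnj orbT //.
have lej : j * kpow n + kpow n <= kbig n.
  by rewrite -mulSnr /kbig addn1 leq_mul2r ltnS lejn orbT.
apply/has_window/idP => [[i lti /andP[_]]|nz].
  rewrite nth_partition_bits //; apply: contraTneq => ->; by rewrite coef0.
have szr := size_root_value w j.
(* The leading coefficient shows that the window is not zero. *)
exists (size (root_value j (tape_point w))).-1.
  by rewrite prednK // size_poly_gt0.
have lt1 : (size (root_value j (tape_point w))).-1 < kpow n.
  by rewrite prednK // size_poly_gt0.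
rewrite nth_partition_bits // -lead_coefE.
have lt2 : j * kpow n + (size (root_value j (tape_point w))).-1 < kbig n by lia.
rewrite lt2 /=; have : lead_coef (root_value j (tape_point w)) != 0%R.
  by rewrite lead_coef_eq0.
by case: (lead_coef _).
Qed.

Lemma answer_le w nu : max_acyclic_matching_size e nu -> answer e t w <= nu.
Proof.
case=> _ maxnu; rewrite /answer; case E: (best _ _ _) => [//|m].
have := best_witness E; rewrite block_root_value.
case/(root_part_sound e_sym e_irr) => M [aM eM].
by have := maxnu M aM; lia.
Qed.

Lemma answer_ge w nu : root_value (2 * nu) (tape_point w) != 0%R ->
  nu <= answer e t w.
Proof.
case: nu => [//|m] nz; apply: best_max; last by rewrite block_root_value.
rewrite ltnNge; apply: contra nz => le; apply/eqP; apply: root_part_large.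
by rewrite card_ord; lia.
Qed.

End Answer.

(** * Polynomial running time *)

(** The base [n + 2] is at least 2 even for [n = 0], which absorbs constants and sums into the
    exponent. *)
Definition poly_bounded (f : nat -> nat) : Prop :=
  exists j, forall n, f n <= (n + 2) ^ j.

Lemma poly_bounded_const c : poly_bounded (fun=> c).
Proof.
exists c => n; apply: leq_trans (ltnW (ltn_expl c (isT : 1 < 2))) _.
by case: c => [//|c]; rewrite leq_exp2r // addn2.
Qed.

Lemma poly_bounded_id : poly_bounded id.
Proof. by exists 1 => n; rewrite expn1 leq_addr. Qed.

Lemma poly_bounded_mul f g :
  poly_bounded f -> poly_bounded g -> poly_bounded (fun n => f n * g n).
Proof.
by move=> [a fa] [b gb]; exists (a + b) => n; rewrite expnD leq_mul.
Qed.

Lemma poly_bounded_add f g :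
  poly_bounded f -> poly_bounded g -> poly_bounded (fun n => f n + g n).
Proof.
move=> [a fa] [b gb]; exists (a + b).+1 => n.
have pos j : 0 < (n + 2) ^ j by rewrite expn_gt0 addn2.
apply: leq_trans (leq_add (fa n) (gb n)) _; rewrite expnS expnD.
move: (pos a) (pos b); move: (_ ^ a) (_ ^ b) => s t; nia.
Qed.

Lemma poly_bounded_exp f j : poly_bounded f -> poly_bounded (fun n => f n ^ j).
Proof.
move=> bf; elim: j => [|j IH]; first exact: poly_bounded_const.
have [a H] := poly_bounded_mul bf IH; exists a => n.
by rewrite expnS; apply: H.
Qed.

Lemma poly_boundedP f : poly_bounded f -> exists c, forall n, f n <= c * n ^ c + c.
Proof.
move=> [j H]; exists (3 ^ j + j) => n; apply: leq_trans (H n) _.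
case: n {H} => [|n].
  apply: leq_trans (_ : 3 ^ j <= _); last by lia.
  by case: j => // j; rewrite leq_exp2r.
apply: leq_trans (leq_addr _ _); apply: leq_trans (_ : 3 ^ j * n.+1 ^ j <= _).
  rewrite -expnMn; case: j => // j; rewrite leq_exp2r //; lia.
by apply: leq_mul; [exact: leq_addr | rewrite leq_pexp2l // leq_addl].
Qed.

Lemma mulcost_mono S S' : S <= S' -> mulcost S <= mulcost S'.
Proof. by move=> le; rewrite /mulcost leq_mul //; lia. Qed.

(** The bag size enters only through the factor [5 ^ b] of [node_cost]; pulling it out leaves a
    quantity polynomial in [n]. *)
Lemma main_cost_mono n N N' b : N <= N' -> main_cost n N b <= 5 ^ b * main_cost n N' 0.
Proof.
move=> leN; rewrite /main_cost /node_cost expn0 !mul1n.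
set S := N * node_size _ _ _ _; set S' := N' * node_size _ _ _ _.
have leS : S <= S' by rewrite /S /S' leq_mul2r leN orbT.
have leM := mulcost_mono leS.
set X := forget_cost S _ _ _ _ + _ + _ + _ + _; set X' := forget_cost S' _ _ _ _ + _ + _ + _ + _.
have leX : X <= X'.
  rewrite /X /X'.
  have leF : forget_cost S n (kpow n) (kbig n) (lookup_cost n) <=
      forget_cost S' n (kpow n) (kbig n) (lookup_cost n).
    rewrite /forget_cost leq_add2r leq_mul2l /=.
    have : n * (mulcost S + 60 * kbig n + 400) <= n * (mulcost S' + 60 * kbig n + 400).
      by rewrite leq_mul2l; apply/orP; right; lia.
    move: (n * _) (n * _) => p q; lia.
  by do 3 apply: leq_add => //; apply: leq_add.
have pos5 : 0 < 5 ^ b by rewrite expn_gt0.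
have add_r a a' r : a <= 5 ^ b * a' -> a + r <= 5 ^ b * (a' + r).
  by move=> le; rewrite mulnDr leq_add // leq_pmull.
do 10 apply add_r.
by rewrite mulnCA leq_mul2l; apply/orP; right; apply: leq_mul.
Qed.

Lemma main_cost_poly d : poly_bounded (fun n => main_cost n (d * n ^ d + d) 0).
Proof.
rewrite /main_cost /node_cost /forget_cost /mulcost /node_size /lookup_cost
  /kbig /kpow /rbits.
by repeat lazymatch goal with
  | |- poly_bounded (fun n => @?f n + @?g n) => apply (@poly_bounded_add f g)
  | |- poly_bounded (fun n => @?f n * @?g n) => apply (@poly_bounded_mul f g)
  | |- poly_bounded (fun n => @?f n ^ ?j) => apply (@poly_bounded_exp f j)
  | |- poly_bounded (fun n => n) => exact poly_bounded_id
  | |- poly_bounded (fun=> ?c) => exact (poly_bounded_const c)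
  end.
Qed.

Lemma dec_enc_nat k : dec_nat (enc_nat k) = Some k.
Proof. by elim: k => //= k; rewrite -/(enc_nat k) => ->. Qed.

Theorem theorem10 :
  exists p : term,
  forall d : nat, exists c : nat,
  forall (n : nat) (e : rel 'I_n) (t : ntd 'I_n) (nu : nat),
    symmetric e -> irreflexive e ->
    nice_tree_decomposition e t ->
    num_nodes t <= d * n ^ d + d ->
    max_acyclic_matching_size e nu ->
    let B := 5 ^ width t * (c * n ^ c + c) in
    (forall w : B.-tuple bool,
       exists2 k : nat, output p e t w B = Some k & k <= nu) /\
    (Pr (fun w : B.-tuple bool => output p e t w B != Some nu) <= 1 / 3%:R)%R.
Proof.
exists main_t => d.
(* The constant 5 pays for bags of [width t + 1] vertices. *)
have [c Hc] := poly_boundedP (poly_bounded_mul (poly_bounded_const 5) (main_cost_poly d)).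
exists c => n e t nu e_sym e_irr dec leN maxnu B.
have [nt _ _] := dec.
have costB : main_cost n (num_nodes t) (max_bag t) <= B.
  apply: leq_trans (main_cost_mono _ _ leN) _.
  apply: leq_trans (_ : 5 ^ (width t).+1 * main_cost n (d * n ^ d + d) 0 <= _).
    by rewrite leq_mul2r leq_exp2l // leqSpred orbT.
  by rewrite expnSr -mulnA leq_mul2l Hc orbT.
have tapeB : n * (rbits n + rbits n) <= B.
  apply: leq_trans costB; rewrite /main_cost; lia.
have outE (w : B.-tuple bool) : output main_t e t w B = Some (answer e t w).
  have [|w' evw] := main_ev e nt (w := w); first by rewrite size_tuple.
  by rewrite /output (ev_run evw costB) /= dec_enc_nat.
split=> [w|].
  by exists (answer e t w) => //; apply: answer_le.
have [[M aM cM] _] := maxnu.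
have [A1 [A2 one]] := root_part_complete e_sym e_irr aM.
(* The 0/1 witness in the order of the tape: even positions carry the x values, odd ones the y
   values. *)
pose bit i := [exists u : 'I_n, (val u == i./2) && (u \in if odd i then A2 else A1)].
have bitE (v : 'I_n) i : i./2 = v -> bit i = (v \in if odd i then A2 else A1).
  move=> ei; apply/existsP/idP => [[u /andP[/eqP eu uA]]|vA].
    by rewrite -(val_inj (etrans eu ei)).
  by exists v; rewrite ei eqxx.
have nz : root_value e (2 * nu) [seq b%:R%R | b : bool <- mkseq bit n.*2] != 0%R.
  rewrite -cM /root_value (_ : root_part _ _ _ _ = 1%R) ?oner_eq0 //.
  apply: etrans one; apply: eq_root_part => v; have ltv := ltn_ord v;
    rewrite (nth_map false) ?size_mkseq ?nth_mkseq; try lia.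
    by rewrite (bitE v) ?doubleK // odd_double.
  by rewrite (bitE v) /= ?uphalf_double // odd_double.
(* There are [2 * n] variables, each spoiled with probability at most [1 / 2 ^ rbits n]; this
   inequality brings the total below 1/3. *)
have le6 : 6 * n <= 2 ^ rbits n.
  rewrite /rbits expnD; have := ltn_expl n (isT : 1 < 2); move: (2 ^ n) => s.
  by lia.
have leB : n.*2 * rbits n <= B by apply: leq_trans tapeB; lia.
have := multiaffine_roots (@root_part_multiaffine n e (2 * nu)) (size_mkseq _ _) nz leB.
set bad := [set w | _] => le_bad.
have sub : #|(fun w : B.-tuple bool => output main_t e t w B != Some nu)| <= #|bad|.
  apply: subset_leq_card; apply/subsetP => w out_ne; rewrite /bad in_set.
  apply: contraNT (out_ne : output main_t e t w B != Some nu) => nzw.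
  rewrite outE; apply/eqP; congr Some; apply/eqP.
  by rewrite eqn_leq (answer_le e_sym e_irr dec _ maxnu) (answer_ge e_sym e_irr dec nzw).
have le3 : 3 * #|bad| <= 2 ^ B.
  have pos : 0 < 2 ^ rbits n by rewrite expn_gt0.
  rewrite -(leq_pmul2r pos); move: le_bad le6; rewrite -mul2n.
  move: (2 ^ rbits n) (2 ^ B) #|bad| => s u b; clear; nia.
rewrite /Pr ler_pdivrMr ?ltr0n ?expn_gt0 // mulrAC mul1r ler_pdivlMr ?ltr0n //.
rewrite -natrM ler_nat; apply: leq_trans le3; rewrite mulnC leq_mul2l /=.
exact: sub.
Qed.
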